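(* Let $\mathbb{G}$ be a Carnot group equipped with its Carnot–Carathéodory distance $d_c$, and let $E$ be a $\sigma$-porous subset of $\mathbb{G}$ (with respect to $d_c$). Then there is a Lipschitz function $f:\mathbb{G}\to\mathbb{R}$ (with respect to $d_c$) which is Pansu subdifferentiable at no point of $E$.
   Context: A Carnot group of step $s$ is a simply connected finite-dimensional Lie group $\mathbb{G}$ whose Lie algebra decomposes as $\mathfrak{g}=V_1\oplus\cdots\oplus V_s$ with non-zero linear subspaces $V_i$, $[V_1,V_i]=V_{i+1}$ for $1\le i\le s-1$ and $[V_1,V_s]=\{0\}$, where $[V,W]=\mathrm{span}\{[X,Y]:X\in V,Y\in W\}$. Fix a basis $X_1,\dots,X_n$ of $\mathfrak{g}$ (left-invariant vector fields) adapted to the stratification, and let $m=\dim V_1$, so $X_1,\dots,X_m$ is a basis of $V_1$. The point $\exp(x_1X_1+\dots+x_nX_n)$ is identified with $(x_1,\dots,x_n)\in\mathbb{R}^n$; the identity is $0$. For $\lambda>0$ the dilation $\delta_\lambda$ is the linear map on $\mathfrak{g}$ with $\delta_\lambda(X)=\lambda^iX$ for $X\in V_i$, transferred to $\mathbb{G}$ via $\exp\circ\delta_\lambda=\delta_\lambda\circ\exp$. An absolutely continuous curve $\gamma:[a,b]\to\mathbb{G}$ is horizontal if there are $u_1,\dots,u_m\in L^1[a,b]$ with $\gamma'(t)=\sum_{i=1}^m u_i(t)X_i(\gamma(t))$ for a.e. $t$; its length is $L(\gamma)=\int_a^b|u(t)|\,dt$ (Euclidean norm of $u=(u_1,\dots,u_m)$).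 $d_c(x,y)$ is the infimum of lengths of horizontal curves joining $x$ to $y$; write $d_c(h)=d_c(h,0)$. A map $L:\mathbb{G}\to\mathbb{R}$ is group linear if $L(xy)=L(x)+L(y)$ and $L(\delta_r(x))=rL(x)$ for all $x,y\in\mathbb{G}$, $r>0$. A map $f:\mathbb{G}\to\mathbb{R}$ is Pansu subdifferentiable at $x_0$ if there is a group linear $L:\mathbb{G}\to\mathbb{R}$ with $\liminf_{h\to0}\frac{f(x_0h)-f(x_0)-L(h)}{d_c(h)}\ge0$. Porosity: let $(M,d)$ be a metric space, $E\subset M$, $B(x,r)$ the open ball. For $\lambda\in(0,1)$ and $a\in E$, $E$ is $\lambda$-porous at $a$ if there is a sequence of points $x_k\in M\setminus\{a\}$ with $x_k\to a$ and $B(x_k,\lambda d(x_k,a))\cap E=\varnothing$ for every $k$. $E$ is porous if there is $\lambda\in(0,1)$ (independent of the point) such that $E$ is $\lambda$-porous at every $a\in E$. A set is $\sigma$-porous if it is a countable union of porous sets. *)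

(* Defs.v *)
From mathcomp Require Import all_boot all_order all_algebra.
From mathcomp Require Import all_classical all_reals all_analysis.

Set Implicit Arguments.
Unset Strict Implicit.
Unset Printing Implicit Defensive.

Import Order.TTheory GRing.Theory Num.Theory.
Import numFieldNormedType.Exports.

Local Open Scope classical_set_scope.
Local Open Scope ring_scope.

(* f is C^k: for k > 0, f is Frechet differentiable everywhere and all its
   directional derivatives are C^(k-1). *)
Fixpoint Ck (R : realType) (V W : normedModType R) (k : nat) (f : V -> W) :
    Prop :=
  match k with
  | 0%N => continuous f
  | k'.+1 => (forall x, differentiable f x) /\
             (forall v, Ck k' (fun x => 'D_v f x))
  end.

Definition smooth (R : realType) (V W : normedModType R) (f : V -> W) : Prop :=
  forall k, Ck k f.

Definition lspan (R : realType) (V : lmodType R) (A : set V) : set V :=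
  [set v | exists (k : nat) (c : 'I_k -> R) (a : 'I_k -> V),
      (forall i, A (a i)) /\ v = \sum_i c i *: a i].

(* The left-invariant vector field whose value at the identity 0 is v: the
   image of v under the differential at 0 of the left translation y |-> x y. *)
Definition left_inv (R : realType) n (mul : 'rV[R]_n -> 'rV[R]_n -> 'rV[R]_n)
  (v x : 'rV[R]_n) : 'rV[R]_n := 'D_v (mul x) 0.

Definition vf_bracket (R : realType) n (X Y : 'rV[R]_n -> 'rV[R]_n)
  (x : 'rV[R]_n) : 'rV[R]_n := 'D_(X x) Y x - 'D_(Y x) X x.

(* The Lie algebra of left-invariant vector fields is identified with the
   tangent space R^n at 0 through X |-> X(0). *)
Definition lie_bracket (R : realType) n
    (mul : 'rV[R]_n -> 'rV[R]_n -> 'rV[R]_n) (v w : 'rV[R]_n) : 'rV[R]_n :=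
  vf_bracket (left_inv mul v) (left_inv mul w) 0.

(* weight j is the index of the layer containing the j-th basis vector. *)
Definition layer_of (R : realType) n (weight : 'I_n -> nat) (i : nat) :
    set 'rV[R]_n :=
  lspan [set delta_mx 0 j | j in [set j | weight j = i]].

(* A Carnot group of step s and dimension n, in exponential coordinates of the
   first kind with respect to a basis X_1, ..., X_n adapted to the
   stratification: the exponential map of a Carnot group is a global
   diffeomorphism, so the group is R^n with a smooth group law, and the point x
   stands for exp (x_1 X_1 + ... + x_n X_n).  That the coordinates are
   exponential is expressed by [cg_exp_coord]: t |-> t x is the one-parameter
   subgroup with initial velocity x.  In particular the inverse of x is - x. *)
Record carnotGroup (R : realType) (n s : nat) := CarnotGroup {
  cg_mul : 'rV[R]_n -> 'rV[R]_n -> 'rV[R]_n ;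
  cg_weight : 'I_n -> nat ;
  cg_mulA : associative cg_mul ;
  cg_mul0x : left_id 0 cg_mul ;
  cg_mulx0 : right_id 0 cg_mul ;
  cg_exp_coord : forall (a b : R) (x : 'rV[R]_n),
    cg_mul (a *: x) (b *: x) = (a + b) *: x ;
  cg_smooth_mul : smooth (fun p : 'rV[R]_n * 'rV[R]_n => cg_mul p.1 p.2) ;
  cg_step_gt0 : (0 < s)%N ;
  cg_weight_bounds : forall j, (0 < cg_weight j <= s)%N ;
  cg_weight_homo : forall i j : 'I_n,
    (i <= j)%N -> (cg_weight i <= cg_weight j)%N ;
  cg_layer_neq0 : forall i, (0 < i <= s)%N ->
    @layer_of R n cg_weight i <> [set 0] ;
  cg_layer_step : forall i, (0 < i < s)%N ->
    lspan [set lie_bracket cg_mul v w | v in layer_of cg_weight 1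
                                      & w in layer_of cg_weight i]
      = layer_of cg_weight i.+1 ;
  cg_layer_last : forall v w,
    layer_of cg_weight 1 v -> layer_of cg_weight s w ->
    lie_bracket cg_mul v w = 0
}.

Section CarnotGroup.
Variables (R : realType) (n s : nat) (G : carnotGroup R n s).

Let mu := @lebesgue_measure R.

Definition basis_field (j : 'I_n) : 'rV[R]_n -> 'rV[R]_n :=
  left_inv (cg_mul G) (delta_mx 0 j).

Definition dilation (r : R) (x : 'rV[R]_n) : 'rV[R]_n :=
  \row_j (r ^+ cg_weight G j * x 0 j).

Definition abs_continuous (a b : R) (g : R -> 'rV[R]_n) : Prop :=
  forall e : R, 0 < e -> exists2 d : R, 0 < d &
    forall (k : nat) (p q : 'I_k -> R),
      (forall i, a <= p i /\ p i <= q i /\ q i <= b) ->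
      trivIset setT (fun i => [set` `]p i, q i[ ]) ->
      \sum_i (q i - p i) < d -> \sum_i `|g (q i) - g (p i)| < e.

(* The curve g on [a, b] is horizontal with controls u.  The controls u_1, ...,
   u_m are the u j with weight j = 1; the other u j are ignored. *)
Definition horizontal (a b : R) (g : R -> 'rV[R]_n) (u : 'I_n -> R -> R) :
    Prop :=
  [/\ abs_continuous a b g,
      forall j, cg_weight G j = 1%N -> mu.-integrable `[a, b] (EFin \o u j) &
      {ae mu, forall t, t \in `]a, b[ ->
        is_derive t (1 : R) g
          (\sum_(j | cg_weight G j == 1%N) u j t *: basis_field j (g t))}].

Definition curve_length (a b : R) (u : 'I_n -> R -> R) : \bar R :=
  (\int[mu]_(t in `[a, b])
    (Num.sqrt (\sum_(j | cg_weight G j == 1%N) u j t ^+ 2))%:E)%E.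

(* The infimum is taken in the extended reals, where that of the empty set is
   +oo; it is always finite by the Chow-Rashevskii theorem. *)
Definition cc_dist (x y : 'rV[R]_n) : \bar R :=
  ereal_inf [set l | exists (a b : R) (g : R -> 'rV[R]_n) (u : 'I_n -> R -> R),
    [/\ a < b, horizontal a b g u, g a = x, g b = y & l = curve_length a b u]].

Definition cc_lipschitz (f : 'rV[R]_n -> R) : Prop :=
  exists2 K : R, 0 <= K &
    forall x y, (`|f x - f y|%:E <= K%:E * cc_dist x y)%E.

Definition group_linear (L : 'rV[R]_n -> R) : Prop :=
  (forall x y, L (cg_mul G x y) = L x + L y) /\
  (forall (r : R) x, 0 < r -> L (dilation r x) = r * L x).

Definition pansu_subdifferentiable (f : 'rV[R]_n -> R) (x0 : 'rV[R]_n) : Prop :=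
  exists2 L : 'rV[R]_n -> R, group_linear L &
    (0 <= limf_einf
      (fun h => (f (cg_mul G x0 h) - f x0 - L h)%R%:E / cc_dist h 0%R)
      (0%R : 'rV[R]_n)^')%E.

End CarnotGroup.

(* Distances take values in the extended reals to match cc_dist. *)
Section Porosity.
Variables (R : realType) (T : Type) (d : T -> T -> \bar R).

Definition porous_at (l : R) (E : set T) (a : T) : Prop :=
  exists x : nat -> T,
    [/\ forall k, x k <> a,
        d (x k) a @[k --> \oo] --> 0%E &
        forall k, [set y | (d (x k) y < l%:E * d (x k) a)%E] `&` E = set0].

Definition porous (E : set T) : Prop :=
  exists2 l : R, 0 < l < 1 & forall a, E a -> porous_at l E a.

Definition sigma_porous (E : set T) : Prop :=
  exists F : nat -> set T, (forall i, porous (F i)) /\ E = \bigcup_i F i.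

End Porosity.

(* Main.v *)
Require Import Defs.
From HB Require Import structures.
From mathcomp Require Import all_boot all_order all_algebra.
From mathcomp Require Import all_classical all_reals all_analysis.
From mathcomp Require Import measurable_realfun.
From mathcomp Require Import ring lra.

Set Implicit Arguments.
Unset Strict Implicit.
Unset Printing Implicit Defensive.

Import Order.TTheory GRing.Theory Num.Theory.
Import numFieldNormedType.Exports.

Local Open Scope classical_set_scope.
Local Open Scope ring_scope.

(** A group linear map [L] is odd for the inversion [h |-> - h], so that a Pansu
    subgradient of [f] at [a] bounds the symmetric differences from below:
      [f (a h) + f (a h^-1) - 2 f a >= - e (d_c h + d_c h^-1)]   for small [h].
    It is therefore enough to build a Lipschitz [f] such that, at every point [a]
    of [E], these symmetric differences are at most [- k * d_c h] for some [k > 0]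
    and some nonzero [h] arbitrarily close to [0].

    For one porous set [F], let [g] be the infimum of [0] and of the bumps
      [rho * phi (delta_(1/rho) (z^-1 y))],   [phi x = min (0, |x|_2^2 - r^2)],
    over all [d_c]-balls of centre [z] and radius [rho <= 1] that miss [F], where
    [r] is so small that the bump is supported in its ball.
    - The distance is left invariant and homogeneous, so all bumps share one
      Lipschitz constant, and [g] is Lipschitz ([gap_lipschitz]).
    - [g] vanishes on [F], is nonpositive, and is at most [- r^2 rho] at the centre
      of such a ball. The balls given by porosity at [a] thus give symmetric
      differences at most [- r^2 l * d_c h] at [a] ([porous_gap_drop]).
    - At every point the symmetric differences of [g] are at most [e |h|] for small
      [h] ([gap_sym_diff]): if [g a = 0] the point is a maximum, and otherwise [g]
      lies below, and at [a] almost touches, a smooth function whose scale [rho] is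
      bounded away from [0]. This one-sided bound is what an infimum of smooth
      functions offers, and it is the side that contradicts subdifferentiability.
    For [E] the union of the porous sets [F_i], take [f = \sum_i c_i g_i] with [c_i]
    decreasing so fast that, at a point of [F_j], the terms after the [j]-th one,
    which are controlled by the Lipschitz constant, cannot compensate the drop of
    [c_j g_j]. The finitely many terms before it contribute at most [e |h|], which
    is at most a multiple of [e * d_c h].

    The remaining work is the geometry of [d_c] in exponential coordinates. Its left
    invariance ([cc_dist_leftE]) and homogeneity ([cc_dist_dil]) hold because
    translations and dilations carry horizontal curves to horizontal curves; for the
    dilations this is [dil_X], which comes from the grading of the Lie algebra.
    Euclidean Lipschitz functions of bounded support are Lipschitz for [d_c]
    ([cc_dist_lipschitz]), which bounds [|h|] by a multiple of [d_c h] for small [h]. Chow's theorem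
    ([hreach_nbhs], [cc_dist_bounded_nbhs]) makes [d_c] finite and bounded near [0].
    Homogeneity then compares [d_c h^-1] with [d_c h] ([cc_norm_opp]). *)

(** * Derivatives of curves *)

Lemma is_derive_diff_comp (R : realType) (V W : normedModType R) (f : V -> W)
    (g : R -> V) (t : R) (v : V) :
  differentiable f (g t) -> is_derive t 1 g v ->
  is_derive t 1 (fun u => f (g u)) ('d f (g t) v).
Proof.
move=> df [dg gv].
have dg' : differentiable g t by apply/derivable1_diffP.
have dfg : differentiable (f \o g) t by exact: differentiable_comp.
split; first exact/derivable1_diffP.
by rewrite -[fun u => _]/(f \o g) deriveE// diff_comp//= -gv [in RHS]deriveE.
Qed.

Lemma is_derive1_pair (R : realType) (V W : normedModType R) (f : R -> V)
    (g : R -> W) (t : R) (v : V) (w : W) :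
  is_derive t 1 f v -> is_derive t 1 g w ->
  is_derive t 1 (fun u => (f u, g u)) (v, w).
Proof.
move=> [df fv] [dg gw].
have df' : differentiable f t by apply/derivable1_diffP.
have dg' : differentiable g t by apply/derivable1_diffP.
have dfg : differentiable (fun u => (f u, g u)) t by exact: differentiable_pair.
split; first exact/derivable1_diffP.
move: fv gw; rewrite !deriveE// diff_pair//= => -> ->.
by [].
Qed.

Lemma is_derive1_scale (R : realType) (V : normedModType R) (v : V) (t : R) :
  is_derive t 1 (fun u => u *: v) v.
Proof.
have dg : differentiable ( *:%R^~ v : R -> V) t by [].
split; first exact/derivable1_diffP.
by rewrite deriveE// diff_val scale1r.
Qed.

Lemma is_derive1_unique (R : realType) (V : normedModType R) (f : R -> V)
    (t : R) (v w : V) :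
  is_derive t 1 f v -> is_derive t 1 f w -> v = w.
Proof. by move=> [_ <-] [_ <-]. Qed.

Lemma is_derive1_affine (R : realType) (V : normedModType R) (x v : V) (t : R) :
  is_derive t 1 (fun u => x + u *: v) v.
Proof.
have := @is_deriveD R R V (fun=> x) (fun t => t *: v) t 1 0 v.
rewrite add0r; apply; exact: is_derive1_scale.
Qed.

Lemma is_derive1_0_cst (R : realType) n (f : R -> 'rV[R]_n) (t : R) :
  (forall u : R, is_derive u 1 f 0) -> f t = f 0.
Proof.
move=> df; apply/rowP => i.
pose g (u : R) : R := f u 0 i.
have dg (u : R) : is_derive u 1 g 0.
  have dc := @differentiable_coord R 1 n (f u) 0 i.
  have := is_derive_diff_comp dc (df u).
  by rewrite linear0.
have cg : continuous g.
  move=> u; apply: differentiable_continuous; apply/derivable1_diffP.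
  by case: (dg u).
have [t0|t0] := leP 0 t.
  have [c _] := @MVT_segment R g (fun=> 0) 0 t t0 (fun x _ => dg x)
    (continuous_subspaceT cg).
  by rewrite mul0r => /eqP; rewrite subr_eq0 => /eqP.
have [c _] := @MVT_segment R g (fun=> 0) t 0 (ltW t0) (fun x _ => dg x)
    (continuous_subspaceT cg).
by rewrite mul0r => /eqP; rewrite subr_eq0 => /eqP.
Qed.

Lemma differentiable_fst_prod (R : realType) (V W : normedModType R)
    (p : V * W) : differentiable (fun p : V * W => p.1) p.
Proof.
have l : linear (fst : V * W -> V) by [].
pose lM := GRing.isLinear.Build _ _ _ _ _ l.
pose L : {linear (V * W)%type -> V} := HB.pack (fst : V * W -> V) lM.
have -> : (fun p : V * W => p.1) = L by [].
apply: linear_differentiable => q; exact: cvg_fst.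
Qed.

Lemma is_derive1_coord (R : realType) n (f : R -> 'rV[R]_n) (t : R)
    (u : 'rV[R]_n) i :
  is_derive t 1 f u -> is_derive t 1 (fun a => f a 0 i : R) (u 0 i).
Proof.
move=> df; have := is_derive_diff_comp (@differentiable_coord R 1 n (f t) 0 i) df.
have -> : 'd (fun N : 'M[R]_(1, n) => N 0 i : R) (f t) u = u 0 i => //.
have @l : {linear 'M[R]_(1, n) -> R}.
  by exists (fun N : 'M[R]_(_, _) => N 0 i); do 2![eexists]; do ?[constructor];
   rewrite ?mxE// => ? *; rewrite ?mxE//; move=> ?; rewrite !mxE.
by rewrite (_ : (fun _ => _) = l)// diff_lin//; exact: coord_continuous.
Qed.

Lemma is_derive1_Zl (R : realType) (V : normedModType R) (f : R -> R) (t a : R)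
    (c : V) :
  is_derive t 1 f a -> is_derive t 1 (fun u => f u *: c) (a *: c).
Proof.
move=> df.
have := @is_derive_diff_comp R R V ( *:%R^~ c) f t a _ df.
by rewrite diff_val; apply.
Qed.

Lemma is_derive1_coords (R : realType) n (f : R -> 'rV[R]_n) (t : R)
    (u : 'rV[R]_n) :
  (forall i, is_derive t 1 (fun a => f a 0 i : R) (u 0 i)) -> is_derive t 1 f u.
Proof.
move=> df.
have -> : f = \sum_i (fun u => f u 0 i *: delta_mx 0 i).
  by apply/funext => a; rewrite fct_sumE [LHS]row_sum_delta.
rewrite [u]row_sum_delta.
by apply: is_derive_sum => i; exact: is_derive1_Zl.
Qed.

(** * The Lie algebra of a Carnot group *)

Section LieTheory.
Variables (R : realType) (n s : nat) (G : carnotGroup R n s).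
Local Notation V := 'rV[R]_n.
Local Notation "x ** y" := (cg_mul G x y) (at level 40, left associativity).
Local Notation X := (left_inv (cg_mul G)).
Local Notation mulp := (fun p : V * V => p.1 ** p.2).
Local Notation ad := (lie_bracket (cg_mul G)).

Lemma mulxN x : x ** (- x) = 0.
Proof. by have := cg_exp_coord G 1 (-1) x; rewrite scale1r scaleN1r subrr scale0r. Qed.

Lemma mulNx x : (- x) ** x = 0.
Proof. by have := cg_exp_coord G (-1) 1 x; rewrite scale1r scaleN1r addNr scale0r. Qed.

Lemma mulKx x y : (- x) ** (x ** y) = y.
Proof. by rewrite (cg_mulA G) mulNx (cg_mul0x G). Qed.

Lemma mulKNx x y : x ** ((- x) ** y) = y.
Proof. by rewrite (cg_mulA G) mulxN (cg_mul0x G). Qed.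

Lemma mulxK x y : (y ** x) ** (- x) = y.
Proof. by rewrite -(cg_mulA G) mulxN (cg_mulx0 G). Qed.

Lemma oppM x y : - (x ** y) = (- y) ** (- x).
Proof.
rewrite -[RHS](cg_mul0x G) -(mulNx (x ** y)) -(cg_mulA G) (cg_mulA G (x ** y)).
by rewrite mulxK mulxN (cg_mulx0 G).
Qed.

Lemma diff_mul p : differentiable mulp p.
Proof. by have [] := cg_smooth_mul G 1. Qed.

Lemma diff_Dmul v p : differentiable (fun q => 'd mulp q v) p.
Proof.
have [_ /(_ v) [h _]] := cg_smooth_mul G 2.
suff -> : (fun q => 'd mulp q v) = (fun q => 'D_v mulp q) by exact: h.
by apply/funext => q; rewrite deriveE//; exact: diff_mul.
Qed.

Lemma mul_derive (p q : R -> V) (t : R) (v w : V) :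
  is_derive t 1 p v -> is_derive t 1 q w ->
  is_derive t 1 (fun u => p u ** q u) ('d mulp (p t, q t) (v, w)).
Proof.
move=> dp dq.
have := is_derive1_pair dp dq.
by apply: (is_derive_diff_comp (f := mulp) (g := fun u => (p u, q u))); exact: diff_mul.
Qed.

Lemma diff_mulr x y : differentiable (cg_mul G x) y.
Proof.
have -> : cg_mul G x = mulp \o (fun y => (x, y)) by [].
by apply: differentiable_comp; [exact: differentiable_pair|exact: diff_mul].
Qed.

Lemma XE v x : X v x = 'd mulp (x, 0) (0, v).
Proof.
rewrite /left_inv.
have h := @is_derive_diff_comp R V V (fun y => x ** y) (fun t => t *: v) 0 v.
have dx y : differentiable (cg_mul G x) y by exact: diff_mulr.
rewrite deriveE//.
have e1 := @mul_derive (fun=> x) (fun t => t *: v) 0 _ _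
  (is_derive_cst x (0:R) 1) (is_derive1_scale v 0).
have := h (dx _) (is_derive1_scale v 0).
rewrite scale0r in e1 *.
by move=> /is_derive1_unique; apply.
Qed.

Lemma XD x v w : X (v + w) x = X v x + X w x.
Proof. by rewrite !XE -linearD; congr ('d _ _ _); rewrite /GRing.add/= /add_pair/= addr0. Qed.

Lemma XZ x a v : X (a *: v) x = a *: X v x.
Proof. by rewrite !XE -linearZ; congr ('d _ _ _); rewrite /GRing.scale/= /scale_pair/= scaler0. Qed.

Lemma X0 x : X 0 x = 0.
Proof. by have := XZ x 0 0; rewrite !scale0r. Qed.

Lemma diff_X v x : differentiable (X v) x.
Proof.
have -> : X v = (fun q => 'd mulp q (0, v)) \o (fun x => (x, 0)).
  by apply/funext => y; rewrite XE.
by apply: differentiable_comp; [exact: differentiable_pair|exact: diff_Dmul].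
Qed.

Lemma dmul_x0 x u v : 'd mulp (x, 0) (u, v) = u + X v x.
Proof.
have -> : (u, v) = (u, 0) + (0, v) :> V * V.
  by rewrite /GRing.add/= /add_pair/= addr0 add0r.
rewrite linearD -XE; congr (_ + _).
have := @mul_derive (fun t => x + t *: u) (fun=> 0) 0 u 0.
rewrite scale0r addr0 => h.
have d0 := is_derive1_affine x u (0 : R).
have := h d0 (is_derive_cst _ _ _).
have -> : (fun u0 : R => (x + u0 *: u) ** 0) = (fun t => x + t *: u).
  by apply/funext => t; rewrite (cg_mulx0 G).
by move=> /is_derive1_unique/(_ d0).
Qed.

Lemma X_at0 v : X v 0 = v.
Proof.
rewrite XE; have := @mul_derive (fun=> 0) (fun t => t *: v) 0 0 v
  (is_derive_cst _ _ _) (is_derive1_scale v 0).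
rewrite scale0r.
have -> : (fun u0 : R => 0 ** (u0 *: v)) = (fun t => t *: v).
  by apply/funext => t; rewrite (cg_mul0x G).
by move=> /is_derive1_unique/(_ (is_derive1_scale v 0)).
Qed.

(** The coordinates are exponential: [t |-> t v] is an integral curve of the
    left-invariant field of [v]. *)
Lemma X_line v t : X v (t *: v) = v.
Proof.
have h : is_derive (0 : R) 1 (fun u => (t *: v) ** (u *: v)) (X v (t *: v)).
  rewrite XE; have := @mul_derive (fun=> t *: v) (fun t => t *: v) 0 0 v
    (is_derive_cst _ _ _) (is_derive1_scale v 0).
  by rewrite scale0r.
apply: (is_derive1_unique h).
have -> : (fun u0 : R => (t *: v) ** (u0 *: v)) = (fun u => t *: v + u *: v).
  by apply/funext => u; rewrite (cg_exp_coord G) scalerDl.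
exact: is_derive1_affine.
Qed.

Definition Ad (x y : V) := (x ** y) ** (- x).

Lemma Ad_mul x y z : Ad x (y ** z) = Ad x y ** Ad x z.
Proof. by rewrite /Ad !(cg_mulA G) -[x ** y ** - x ** x](cg_mulA G) mulNx (cg_mulx0 G). Qed.

Lemma AdM x y z : Ad (x ** y) z = Ad x (Ad y z).
Proof. by rewrite /Ad oppM !(cg_mulA G). Qed.

Lemma Ad0x y : Ad 0 y = y.
Proof. by rewrite /Ad oppr0 (cg_mul0x G) (cg_mulx0 G). Qed.

Lemma Adx0 x : Ad x 0 = 0.
Proof. by rewrite /Ad (cg_mulx0 G) mulxN. Qed.

Lemma mulxx x : x ** x = 2 *: x.
Proof. by have := cg_exp_coord G 1 1 x; rewrite !scale1r. Qed.

Lemma Ad_2 x y : Ad x (2 *: y) = 2 *: Ad x y.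
Proof. by rewrite -!mulxx Ad_mul. Qed.

(** Conjugation is a group morphism and [x ** x = 2 x], hence it commutes with
    halving. Together with differentiability at [0] this forces it to be linear. *)
Lemma Ad_half x y k : Ad x (2^-1 ^+ k *: y) = 2^-1 ^+ k *: Ad x y.
Proof.
elim: k y => [|k IH] y; first by rewrite expr0 !scale1r.
rewrite exprSr -scalerA IH -scalerA; congr (_ *: _).
have -> : Ad x y = 2 *: Ad x (2^-1 *: y).
  by rewrite -Ad_2 scalerA divff// scale1r.
by rewrite scalerA mulVf// scale1r.
Qed.

Lemma diff_Adp p : differentiable (fun p : V * V => Ad p.1 p.2) p.
Proof.
rewrite /Ad.
have -> : (fun p : V * V => p.1 ** p.2 ** - p.1) =
   mulp \o (fun p => (mulp p, - p.1)) by [].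
apply: differentiable_comp; last exact: diff_mul.
apply: differentiable_pair; first exact: diff_mul.
by apply: (@differentiableN _ _ _ (fun p : V * V => p.1)); exact: differentiable_fst_prod.
Qed.

Lemma diff_Adr x y : differentiable (Ad x) y.
Proof.
have -> : Ad x = (fun p : V * V => Ad p.1 p.2) \o (fun y => (x, y)) by [].
by apply: differentiable_comp; [exact: differentiable_pair|exact: diff_Adp].
Qed.

(** [Ad x y = 2^k Ad x (2^-k y)] for every [k], and the right-hand side tends to
    the derivative at [0] in the direction [y]. *)
Lemma Ad_E x y : Ad x y = 'd (Ad x) 0 y.
Proof.
have d : differentiable (Ad x) 0 by exact: diff_Adr.
rewrite -deriveE//.
have /cvg_ex[l] := @diff_derivable _ _ _ _ _ y d.
move=> h; rewrite /derive (cvg_lim _ h)//.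
have h2 : (2^-1 ^+ k : R) @[k --> \oo] --> 0^'.
  have hh : (2^-1 ^+ k : R) @[k --> \oo] --> (0 : R).
    by apply: cvg_expr; rewrite ger0_norm// invf_lt1// ltr1n.
  move=> A A0; have := hh _ A0; rewrite /= !near_simpl; apply: filterS => k; apply.
  by rewrite expf_neq0// invr_neq0.
have := cvg_comp _ _ h2 h.
rewrite (_ : _ \o _ = fun=> Ad x y); last first.
  by apply/funext => k /=; rewrite addr0 Adx0 subr0 Ad_half scalerA mulVf ?scale1r//
    expf_neq0// invr_neq0.
move=> h3; rewrite -(cvg_lim _ h3)//.
by rewrite lim_cst.
Qed.

Lemma AdD x y z : Ad x (y + z) = Ad x y + Ad x z.
Proof. by rewrite !(Ad_E x) linearD. Qed.

Lemma AdZ x a y : Ad x (a *: y) = a *: Ad x y.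
Proof. by rewrite !(Ad_E x) linearZ. Qed.

Lemma AdN x y : Ad x (- y) = - Ad x y.
Proof. by rewrite -scaleN1r AdZ scaleN1r. Qed.

Lemma dAdr x y w : 'd (Ad x) y w = Ad x w.
Proof.
have h1 := is_derive1_affine y w (0 : R).
have d : differentiable (Ad x) (y + 0 *: w) by exact: diff_Adr.
have := is_derive_diff_comp d h1; rewrite scale0r addr0 => h2.
have h3 := is_derive1_affine (Ad x y) (Ad x w) (0 : R).
apply: (is_derive1_unique h2).
by under eq_fun do rewrite AdD AdZ.
Qed.

Lemma Ad_derive x (p : R -> V) (t : R) (v : V) :
  is_derive t 1 p v -> is_derive t 1 (fun u => Ad x (p u)) (Ad x v).
Proof.
by move=> dp; have := is_derive_diff_comp (diff_Adr x (p t)) dp; rewrite dAdr.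
Qed.

(** Inversion is [y |-> - y] and exchanges left and right translations, so it
    expresses right-invariant fields through left-invariant ones. *)
Lemma X_opp x y : 'd mulp (0, y) (x, 0) = X x (- y).
Proof.
have h1 := @mul_derive (fun t => t *: x) (fun=> y) 0 x 0 (is_derive1_scale x 0)
  (is_derive_cst _ _ _).
rewrite scale0r in h1.
apply: (is_derive1_unique h1).
have -> : (fun u : R => u *: x ** y) = - (fun u : R => (- y) ** (u *: (- x))).
  apply/funext => u; rewrite -[LHS]opprK oppM -scalerN.
  by [].
have h2 := @mul_derive (fun=> - y) (fun t => t *: (- x)) 0 0 (- x) (is_derive_cst _ _ _)
  (is_derive1_scale (- x) 0).
have := is_deriveN h2; rewrite scale0r.
by rewrite -XE -[in X (- x)]scaleN1r XZ scaleN1r opprK.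
Qed.

(** Splitting [Ad (t x) y] into a left and a right translation: the infinitesimal
    action of [Ad] is a difference of a right- and a left-invariant field. *)
Lemma ad0_derive x y : is_derive (0 : R) 1 (fun t => Ad (t *: x) y) (X x (- y) - X x y).
Proof.
have h1 := @mul_derive (fun t => t *: x) (fun=> y) 0 x 0 (is_derive1_scale x 0)
  (is_derive_cst _ _ _).
rewrite scale0r X_opp in h1.
have h2 := @mul_derive _ (fun t => t *: (- x)) 0 _ (- x) h1 (is_derive1_scale (- x) 0).
rewrite scale0r (cg_mul0x G) scale0r dmul_x0 in h2.
rewrite -[in X (- x)]scaleN1r XZ scaleN1r in h2.
by under eq_fun do rewrite /Ad -scalerN.
Qed.

Lemma X_line_derive x y : is_derive (0 : R) 1 (fun t => X x (t *: y)) ('d (X x) 0 y).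
Proof.
have d : differentiable (X x) (0 *: y) by exact: diff_X.
by have := is_derive_diff_comp d (is_derive1_scale y 0); rewrite scale0r.
Qed.

(** The left-hand side is linear in [y], because [Ad] is; so it equals its own
    derivative at [0], which is the right-hand side. *)
Lemma ad_X x y : X x (- y) - X x y = - 2 *: 'd (X x) 0 y.
Proof.
pose a z := X x (- z) - X x z.
have aZ t : a (t *: y) = t *: a y.
  have h := ad0_derive x (t *: y).
  apply: (is_derive1_unique h).
  under eq_fun do rewrite AdZ.
  exact: (is_deriveZ t (ad0_derive x y)).
have h1 := X_line_derive x y.
have h2 := X_line_derive x (- y).
have h3 := is_deriveB h2 h1.
apply: (@is_derive1_unique R V (fun t => a (t *: y)) 0).
  by under eq_fun do rewrite aZ; exact: is_derive1_scale.
rewrite linearN -opprD -mulr2n -scaler_nat -scaleNr in h3.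
by under eq_fun do rewrite /a -scalerN.
Qed.

(** An opaque copy of the bilinear map [(x, y) |-> 'd (X x) 0 y]: unification
    would otherwise unfold derivatives when it compares two of its values. *)
Fact dX_sealed : {b : V -> V -> V | forall x y, 'd (X x) 0 y = b x y}.
Proof. by exists (fun x y => 'd (X x) 0 y). Qed.
Let B := sval dX_sealed.
Let BE x y : 'd (X x) 0 y = B x y := svalP dX_sealed x y.

(** The Lie bracket, made opaque for the same reason. *)
Fact bracket_sealed : {b : V -> V -> V | forall x y, ad x y = b x y}.
Proof. by exists ad. Qed.
Definition bracket := sval bracket_sealed.
Lemma bracketE x y : ad x y = bracket x y.
Proof. exact: (svalP bracket_sealed x y). Qed.

Let B_derive x y : is_derive (0 : R) 1 (fun t => X x (t *: y)) (B x y).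
Proof. rewrite -BE; exact: X_line_derive. Qed.

(** [X x] is constant along the line [t x], by [X_line]. *)
Let B_alt x : B x x = 0.
Proof.
apply: (is_derive1_unique (B_derive x x)).
by under eq_fun do rewrite X_line; exact: is_derive_cst.
Qed.

Let B_addl x y z : B (x + y) z = B x z + B y z.
Proof.
apply: (is_derive1_unique (B_derive (x + y) z)).
under eq_fun do rewrite XD.
exact: (is_deriveD (B_derive x z) (B_derive y z)).
Qed.

Let B_addr x y z : B x (y + z) = B x y + B x z.
Proof. by rewrite -!BE linearD. Qed.

Let B_scaler x a y : B x (a *: y) = a *: B x y.
Proof. by rewrite -!BE linearZ. Qed.

Let B_anti x y : B x y = - B y x.
Proof.
have := B_alt (x + y); rewrite B_addl !B_addr !B_alt addr0 add0r => /eqP.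
by rewrite addr_eq0 => /eqP.
Qed.

Let bracketB x y : bracket x y = (- 2) *: B x y.
Proof.
rewrite -bracketE.
have -> : ad x y = 'D_(X x 0) (X y) 0 - 'D_(X y 0) (X x) 0 by [].
rewrite !X_at0 !deriveE; try exact: diff_X.
have -> : 'd (X y) 0 x - 'd (X x) 0 y = B y x - B x y by congr (_ - _); exact: BE.
by rewrite (B_anti y x) -opprD -mulr2n -scaler_nat scaleNr.
Qed.

(** Both sides are [- 2 B x y]: the bracket because [B] is skew-symmetric, the
    derivative of [Ad] by [ad_X]. *)
Lemma bracket_derive0 x y : is_derive (0 : R) 1 (fun t => Ad (t *: x) y) (bracket x y).
Proof. by rewrite bracketB -BE -ad_X; exact: ad0_derive. Qed.

Lemma bracket_anti x y : bracket x y = - bracket y x.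
Proof. by rewrite !bracketB B_anti scalerN. Qed.

Lemma bracketDr x y z : bracket x (y + z) = bracket x y + bracket x z.
Proof. by rewrite !bracketB B_addr scalerDr. Qed.

Lemma bracketZr x a y : bracket x (a *: y) = a *: bracket x y.
Proof. by rewrite !bracketB B_scaler !scalerA mulrC. Qed.

Lemma bracketDl x y z : bracket (x + y) z = bracket x z + bracket y z.
Proof. by rewrite bracket_anti bracketDr opprD -!bracket_anti. Qed.

Lemma bracketZl x a y : bracket (a *: x) y = a *: bracket x y.
Proof. by rewrite bracket_anti bracketZr -scalerN -bracket_anti. Qed.

Lemma dAd0 w u v : 'd (fun p : V * V => Ad p.1 p.2) (0, w) (u, v) = bracket u w + v.
Proof.
have -> : (u, v) = (u, 0) + (0, v) :> V * V.
  by rewrite /GRing.add/= /add_pair/= addr0 add0r.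
rewrite linearD; congr (_ + _).
- have d : differentiable (fun p : V * V => Ad p.1 p.2) (0 *: u, w) by exact: diff_Adp.
  have := is_derive_diff_comp (g := fun t : R => (t *: u, w)) d
    (is_derive1_pair (is_derive1_scale u 0) (is_derive_cst _ _ _)).
  by rewrite scale0r => /is_derive1_unique; apply; exact: bracket_derive0.
- have d : differentiable (fun p : V * V => Ad p.1 p.2) (0, w + 0 *: v) by exact: diff_Adp.
  have := is_derive_diff_comp (g := fun t : R => (0, w + t *: v)) d
    (is_derive1_pair (is_derive_cst _ _ _) (is_derive1_affine w v 0)).
  rewrite scale0r addr0 => /is_derive1_unique; apply.
  by under eq_fun do rewrite Ad0x; exact: is_derive1_affine.
Qed.

Lemma Ad_derive0 x (p : R -> V) (v : V) :
  is_derive (0 : R) 1 p v ->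
  is_derive (0 : R) 1 (fun t => Ad (t *: x) (p t)) (bracket x (p 0) + v).
Proof.
move=> dp; have d : differentiable (fun p : V * V => Ad p.1 p.2) (0 *: x, p 0) by exact: diff_Adp.
have := is_derive_diff_comp (g := fun t : R => (t *: x, p t)) d
    (is_derive1_pair (is_derive1_scale x 0) dp).
by rewrite scale0r dAd0.
Qed.

Lemma bracketNl x y : bracket (- x) y = - bracket x y.
Proof. by rewrite -scaleN1r bracketZl scaleN1r. Qed.

Lemma bracketx0 x : bracket x 0 = 0.
Proof. by have := bracketZr x 0 0; rewrite !scale0r. Qed.

Lemma bracket0x x : bracket 0 x = 0.
Proof. by have := bracketZl 0 0 x; rewrite !scale0r. Qed.

Lemma Ad_scaleD x (a b : R) y : Ad ((a + b) *: x) y = Ad (a *: x) (Ad (b *: x) y).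
Proof. by rewrite -AdM (cg_exp_coord G). Qed.

(** One-parameter identities reduce derivatives at time [t] to derivatives at [0]. *)
Lemma is_derive1_shift (f : R -> V) (t : R) (v : V) :
  is_derive (0 : R) 1 (fun u => f (t + u)) v -> is_derive t 1 f v.
Proof.
move=> h.
have d : is_derive t 1 (fun u : R => u - t) (1 : R).
  have := @is_derive1_affine R R (- t) 1 t.
  by under eq_fun do rewrite addrC [_ *: _]mulr1.
have df : differentiable (fun u => f (t + u)) (t - t).
  by apply/derivable1_diffP; rewrite subrr; case: h.
have := is_derive_diff_comp (g := fun u => u - t) df d; rewrite subrr.
under eq_fun do rewrite addrC subrK.
have [_ <-] := h; rewrite deriveE//.
by move: df; rewrite subrr.
Qed.

(** [Ad x (Ad (u y) z) = Ad (u (Ad x y)) (Ad x z)]; differentiate at [u = 0]. *)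
Lemma Ad_bracket x y z : Ad x (bracket y z) = bracket (Ad x y) (Ad x z).
Proof.
apply: (is_derive1_unique (Ad_derive x (bracket_derive0 y z))).
suff -> : (fun u : R => Ad x (Ad (u *: y) z)) = (fun u => Ad (u *: Ad x y) (Ad x z)).
  exact: bracket_derive0.
apply/funext => u; rewrite -AdZ -!AdM; congr (Ad _ z).
by rewrite /Ad -(cg_mulA G _ (- x)) mulNx (cg_mulx0 G).
Qed.

Lemma bracket_sum x I (r : seq I) (P : pred I) (F : I -> V) :
  bracket x (\sum_(i <- r | P i) F i) = \sum_(i <- r | P i) bracket x (F i).
Proof. by apply: (big_morph (bracket x) (bracketDr x) (bracketx0 x)). Qed.

Lemma bracket_suml x I (r : seq I) (P : pred I) (F : I -> V) :
  bracket (\sum_(i <- r | P i) F i) x = \sum_(i <- r | P i) bracket (F i) x.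
Proof.
by apply: (big_morph (bracket^~ x) (fun y z => bracketDl y z x) (bracket0x x)).
Qed.

Lemma is_derive1_bracket (p q : R -> V) (t : R) (v w : V) :
  is_derive t 1 p v -> is_derive t 1 q w ->
  is_derive t 1 (fun u => bracket (p u) (q u)) (bracket v (q t) + bracket (p t) w).
Proof.
move=> dp dq.
have -> : (fun u => bracket (p u) (q u)) =
    \sum_i \sum_j (fun u => (p u 0 i * q u 0 j) *:
       bracket (delta_mx 0 i) (delta_mx 0 j)).
  apply/funext => u; rewrite fct_sumE.
  rewrite [in LHS](row_sum_delta (p u)) [in LHS](row_sum_delta (q u)) bracket_suml.
  apply: eq_bigr => i _; rewrite bracket_sum fct_sumE; apply: eq_bigr => j _.
  by rewrite bracketZl bracketZr scalerA.
have -> : bracket v (q t) + bracket (p t) w = \sum_i \sum_j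
    (p t 0 i *: w 0 j + q t 0 j *: v 0 i) *: bracket (delta_mx 0 i) (delta_mx 0 j).
  rewrite [in LHS](row_sum_delta v) [in LHS](row_sum_delta (p t)) !bracket_suml -big_split/=.
  apply: eq_bigr => i _; rewrite [in LHS](row_sum_delta w) [in LHS](row_sum_delta (q t)).
  rewrite !bracket_sum -big_split/=; apply: eq_bigr => j _.
  rewrite !bracketZl !bracketZr !scalerA -scalerDl; congr (_ *: _).
  by rewrite addrC [v 0 i * _]mulrC.
apply: is_derive_sum => i; apply: is_derive_sum => j; apply: is_derive1_Zl.
exact: (is_deriveM (is_derive1_coord _ dp) (is_derive1_coord _ dq)).
Qed.

(** Jacobi identity: the derivative at [t = 0] of [Ad_bracket] for [Ad (t x)]. *)
Lemma bracket_derivation x y z :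
  bracket x (bracket y z) = bracket (bracket x y) z + bracket y (bracket x z).
Proof.
apply: (is_derive1_unique (bracket_derive0 x (bracket y z))).
have := is_derive1_bracket (bracket_derive0 x y) (bracket_derive0 x z).
rewrite scale0r !Ad0x.
by under [in X in _ -> X]eq_fun do rewrite Ad_bracket.
Qed.

Local Notation wt := (cg_weight G).
Local Notation layer := (@layer_of R n wt).

Lemma layer_span i (x : V) : (forall j, wt j != i -> x 0 j = 0) -> layer i x.
Proof.
move=> h.
pose I := [seq j <- enum 'I_n | wt j == i].
exists (size I), (fun k => x 0 (tnth (in_tuple I) k)), (fun k => delta_mx 0 (tnth (in_tuple I) k)).
split.
  move=> k; exists (tnth (in_tuple I) k) => //=.
  by have := mem_tnth k (in_tuple I); rewrite mem_filter => /andP[/eqP].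
rewrite [LHS]row_sum_delta.
transitivity (\sum_(j <- I) x 0 j *: delta_mx 0 j : V); last first.
  by rewrite (big_tnth _ _ I).
rewrite big_filter big_enum_cond/= (bigID (fun j => wt j == i))/= [X in _ + X]big1 ?addr0//.
by move=> j wj; rewrite h// scale0r.
Qed.

(** A layer is the coordinate subspace of the basis vectors of its weight, which
    replaces linear spans by conditions on coordinates. *)
Lemma layerP i (x : V) : layer i x <-> (forall j, wt j != i -> x 0 j = 0).
Proof.
split=> [[k [c [a [ha ->]]]] j wj|]; last exact: layer_span.
rewrite summxE big1// => l _; rewrite mxE.
have [m /= wm <-] := ha l; rewrite mxE/=.
case: eqP => [jm|_]; last by rewrite mulr0.
by move: wj; rewrite jm wm eqxx.
Qed.

Lemma layer_sum i I (r : seq I) (P : pred I) (F : I -> V) :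
  (forall k, P k -> layer i (F k)) -> layer i (\sum_(k <- r | P k) F k).
Proof.
move=> h; apply/layerP => j wj; rewrite summxE big1// => k Pk.
by have /layerP := h k Pk; exact.
Qed.

Lemma layerZ i a x : layer i x -> layer i (a *: x).
Proof. by move=> /layerP h; apply/layerP => j wj; rewrite mxE h// mulr0. Qed.

Lemma layerD i x y : layer i x -> layer i y -> layer i (x + y).
Proof.
by move=> /layerP hx /layerP hy; apply/layerP => j wj; rewrite mxE hx// hy// addr0.
Qed.

Lemma layer_basis j : layer (wt j) (delta_mx 0 j).
Proof.
apply/layerP => k; rewrite mxE/=.
by have [->|//] := eqVneq k j; rewrite eqxx.
Qed.

Lemma layer_out i x : ~~ (0 < i <= s)%N -> layer i x -> x = 0.
Proof.
move=> hi /layerP h; apply/rowP => j; rewrite mxE h//.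
by apply: contra hi => /eqP <-; exact: cg_weight_bounds.
Qed.

Lemma layer0 i : layer i 0.
Proof. by apply/layerP => j _; rewrite mxE. Qed.

Lemma bracket_layer1 j x y : layer 1 x -> layer j y -> layer j.+1 (bracket x y).
Proof.
move=> hx hy.
have [js|] := boolP (0 < j <= s)%N; last first.
  by move=> /layer_out/(_ hy) ->; rewrite bracketx0; exact: layer0.
rewrite -bracketE; move: js => /andP[j0]; rewrite leq_eqVlt => /orP[/eqP js|js].
  move: hy; rewrite js => hy.
  by rewrite (cg_layer_last hx hy); exact: layer0.
rewrite -(cg_layer_step G (i := j)) ?j0//.
exists 1%N, (fun=> 1), (fun=> ad x y); split; last by rewrite big_ord1 scale1r.
by move=> _; exists x => //; exists y.
Qed.

(** The stratification is a grading: only brackets with the first layer are given,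
    and the general case follows by induction on [i] from the Jacobi identity,
    since the layer [i + 1] is spanned by brackets of the layers [1] and [i]. *)
Lemma bracket_layer i j x y :
  (0 < i)%N -> layer i x -> layer j y -> layer (i + j) (bracket x y).
Proof.
case: i => // i _; elim: i x j y => [|i IH] x j y hx hy; first exact: bracket_layer1.
have [is_|] := ltnP i.+1 s; last first.
  move=> si; rewrite (@layer_out i.+2 x)//; last by rewrite -leqNgt.
  by rewrite bracket0x; exact: layer0.
have : layer i.+2 x by [].
rewrite -(cg_layer_step G (i := i.+1)) ?is_// => -[k [c [a [ha ->]]]].
rewrite bracket_suml; apply: layer_sum => l _; rewrite bracketZl; apply: layerZ.
have [u hu [v hv <-]] := ha l; rewrite bracketE.
have -> : bracket (bracket u v) y = bracket u (bracket v y) - bracket v (bracket u y).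
  by rewrite (bracket_derivation u) addrK.
apply: layerD; first by rewrite addSn; apply: bracket_layer1 => //; exact: IH.
rewrite -scaleN1r; apply: layerZ; rewrite addSnnS; apply: IH => //.
exact: bracket_layer1.
Qed.

Local Notation dil := (dilation G).

Lemma dilD r x y : dil r (x + y) = dil r x + dil r y.
Proof. by apply/rowP => j; rewrite !mxE mulrDr. Qed.

Lemma dilZ r a x : dil r (a *: x) = a *: dil r x.
Proof. by apply/rowP => j; rewrite !mxE mulrCA. Qed.

Lemma dil0 r : dil r 0 = 0.
Proof. by apply/rowP => j; rewrite !mxE mulr0. Qed.

Lemma dil_sum r I (l : seq I) (P : pred I) (F : I -> V) :
  dil r (\sum_(k <- l | P k) F k) = \sum_(k <- l | P k) dil r (F k).
Proof. by apply: (big_morph (dil r) (dilD r) (dil0 r)). Qed.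

Lemma dilN r x : dil r (- x) = - dil r x.
Proof. by rewrite -scaleN1r dilZ scaleN1r. Qed.

Lemma dil_layer r i x : layer i x -> dil r x = r ^+ i *: x.
Proof.
move=> /layerP h; apply/rowP => j; rewrite !mxE.
by have [->//|wj] := eqVneq (wt j) i; rewrite h// !mulr0.
Qed.

Lemma dil_bracket r x y : dil r (bracket x y) = bracket (dil r x) (dil r y).
Proof.
rewrite [in LHS](row_sum_delta x) [in LHS](row_sum_delta y).
rewrite [in RHS](row_sum_delta x) [in RHS](row_sum_delta y).
rewrite !dil_sum !bracket_suml dil_sum; apply: eq_bigr => i _.
rewrite !bracket_sum dil_sum; apply: eq_bigr => j _.
have wi : (0 < wt i)%N by have /andP[] := cg_weight_bounds G i.
rewrite !dilZ !bracketZl !bracketZr !dilZ; congr (_ *: (_ *: _)).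
rewrite !(dil_layer _ (layer_basis _)) bracketZl bracketZr scalerA -exprD.
by rewrite (dil_layer _ (bracket_layer wi (layer_basis i) (layer_basis j))).
Qed.

Lemma is_derive1_dil r (p : R -> V) (t : R) v :
  is_derive t 1 p v -> is_derive t 1 (fun u => dil r (p u)) (dil r v).
Proof.
move=> dp; apply: is_derive1_coords => i; rewrite mxE.
under eq_fun do rewrite mxE.
exact: (is_deriveZ (r ^+ wt i) (is_derive1_coord i dp)).
Qed.

(** [Ad (- t (dil r x)) (dil r (Ad (t x) y))] does not depend on [t]: its derivative
    vanishes because [dil r] is an automorphism of the Lie algebra. *)
Lemma dil_Ad r x y : dil r (Ad x y) = Ad (dil r x) (dil r y).
Proof.
pose k (t : R) := Ad (t *: - dil r x) (dil r (Ad (t *: x) y)).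
have dk t : is_derive (t : R) 1 k 0.
  apply: is_derive1_shift; rewrite -(Adx0 (t *: - dil r x)).
  set z := Ad (t *: x) y.
  have -> : (fun u => k (t + u)) = (fun u =>
      Ad (t *: - dil r x) (Ad (u *: - dil r x) (dil r (Ad (u *: x) z)))).
    by apply/funext => u; rewrite /k (Ad_scaleD (- dil r x) t u) (addrC t u) (Ad_scaleD x u t).
  apply: Ad_derive.
  have h := Ad_derive0 (- dil r x) (is_derive1_dil r (bracket_derive0 x z)).
  by move: h; rewrite scale0r Ad0x bracketNl dil_bracket addNr.
have := is_derive1_0_cst 1 dk; rewrite /k !scale0r !scale1r !Ad0x => h.
by rewrite -h -AdM mulxN Ad0x.
Qed.

Lemma X_derive_comp x (q : R -> V) v : q 0 = 0 -> is_derive (0 : R) 1 q v ->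
  is_derive (0 : R) 1 (fun t => x ** q t) (X v x).
Proof.
move=> q0 dq; rewrite XE.
have := @mul_derive (fun=> x) q 0 0 v (is_derive_cst _ _ _) dq.
by rewrite q0.
Qed.

(** The left-invariant Maurer-Cartan form: [theta x] is the inverse of
    [v |-> X v x], and is easier to compare with dilations. *)
Let theta x v := 'd mulp (- x, x) (0, v).

Let theta_derive x v : is_derive (0 : R) 1 (fun t => (- x) ** (x + t *: v)) (theta x v).
Proof.
have := @mul_derive (fun=> - x) (fun t => x + t *: v) 0 0 v (is_derive_cst _ _ _)
  (is_derive1_affine x v 0).
by rewrite scale0r addr0.
Qed.

Let theta_derive_comp x (p : R -> V) v : p 0 = x -> is_derive (0 : R) 1 p v ->
  is_derive (0 : R) 1 (fun t => (- x) ** p t) (theta x v).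
Proof.
move=> p0 dp; have := @mul_derive (fun=> - x) p 0 0 v (is_derive_cst _ _ _) dp.
by rewrite p0.
Qed.

Let theta_X x v : theta x (X v x) = v.
Proof.
have h' := theta_derive_comp _ (X_derive_comp x (scale0r v) (is_derive1_scale v 0)).
rewrite scale0r (cg_mulx0 G) in h'.
apply: (is_derive1_unique (h' x erefl)).
by under eq_fun do rewrite mulKx; exact: is_derive1_scale.
Qed.

Let X_theta x v : X (theta x v) x = v.
Proof.
have h := X_derive_comp x _ (theta_derive x v).
rewrite scale0r addr0 mulNx in h.
apply: (is_derive1_unique (h erefl)).
by under eq_fun do rewrite mulKNx; exact: is_derive1_affine.
Qed.

Let mul_derive0 (p q : R -> V) v u : p 0 = 0 -> q 0 = 0 ->
  is_derive (0 : R) 1 p v -> is_derive (0 : R) 1 q u ->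
  is_derive (0 : R) 1 (fun t => p t ** q t) (v + u).
Proof.
move=> p0 q0 dp dq; have := mul_derive dp dq.
by rewrite p0 q0 dmul_x0 X_at0.
Qed.

Let thetaZ x a v : theta x (a *: v) = a *: theta x v.
Proof.
by rewrite /theta -linearZ; congr ('d _ _ _); rewrite /GRing.scale/= /scale_pair/= scaler0.
Qed.

Let Theta x v (a : R) := theta (a *: x) (a *: v).

(** A cocycle identity, read off from [(a + b) x = (a x) ** (b x)]. Together with
    the derivative at [0] it determines [Theta x v]. *)
Let Theta_add x v a b : Theta x v (a + b) = Ad (b *: - x) (Theta x v a) + Theta x v b.
Proof.
have ha := theta_derive (a *: x) (a *: v).
have hb := theta_derive (b *: x) (b *: v).
have hab := theta_derive ((a + b) *: x) ((a + b) *: v).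
have z0 y z : (- y) ** (y + (0 : R) *: z) = 0 by rewrite scale0r addr0 mulNx.
have haA := Ad_derive (b *: - x) ha.
have hm := mul_derive0 _ (z0 _ _) haA hb.
apply: (is_derive1_unique hab).
have -> : (fun t => - ((a + b) *: x) ** ((a + b) *: x + t *: ((a + b) *: v))) =
   (fun t => Ad (b *: - x) (- (a *: x) ** (a *: x + t *: (a *: v))) **
      (- (b *: x) ** (b *: x + t *: (b *: v)))).
  apply/funext => t.
  have e c : c *: x + t *: (c *: v) = c *: (x + t *: v).
    by rewrite scalerDr !scalerA mulrC.
  have e1 : - ((a + b) *: x) = (b *: - x) ** (a *: - x).
    by rewrite (cg_exp_coord G) addrC scalerN.
  have e2 : (a + b) *: (x + t *: v) = (a *: (x + t *: v)) ** (b *: (x + t *: v)).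
    by rewrite (cg_exp_coord G).
  rewrite !e e1 e2 /Ad -[- (a *: x)]scalerN -[- (b *: x)]scalerN -!(cg_mulA G).
  rewrite -[- (b *: - x)]scalerN opprK.
  congr (_ ** (_ ** (_ ** _))).
  by rewrite (cg_mulA G (b *: x)) scalerN mulxN (cg_mul0x G).
by apply: hm; rewrite z0 Adx0.
Qed.

Let Theta0 x v : Theta x v 0 = 0.
Proof. by rewrite /Theta !scale0r /theta linear0. Qed.

(** [Theta x v a = a * theta (a x) v], and [theta (a x) v] tends to [theta 0 v = v]. *)
Let Theta_derive0 x v : is_derive (0 : R) 1 (Theta x v) v.
Proof.
pose H (a : R) := theta (a *: x) v.
have cH : H @ (0 : R) --> H 0.
  apply: differentiable_continuous.
  have -> : H = (fun q => 'd mulp q (0, v)) \o (fun a => (- (a *: x), a *: x)).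
    by [].
  apply: differentiable_comp; last exact: diff_Dmul.
  apply: differentiable_pair; last by [].
  by apply: differentiableN.
have H0 : H 0 = v.
  rewrite /H; apply: (is_derive1_unique (theta_derive _ _)).
  under eq_fun do rewrite scale0r oppr0 (cg_mul0x G) add0r.
  exact: is_derive1_scale.
have h : (fun h => h^-1 *: ((Theta x v \o shift 0) (h *: (1 : R)) - Theta x v 0)) @
    (0 : R)^' --> v.
  rewrite -[in X in _ --> X]H0.
  apply: cvg_trans (cvg_trans _ cH); last exact: (cvg_app _ (@nbhs_dnbhs _ _)).
  apply: near_eq_cvg; near=> a.
  have a0 : a != 0 by near: a; exact: nbhs_dnbhs_neq.
  rewrite /= Theta0 subr0 addr0 [a%:A]mulr1 /H /Theta.
  by rewrite thetaZ scalerA mulVf// scale1r.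
split; first by apply/cvg_ex; exists v.
exact: cvg_lim h.
Unshelve. all: by end_near. Qed.

(** By [dil_Ad], the difference [D] of both sides along the line of [x] satisfies the
    same cocycle identity and has derivative [0] at [0]; so its derivative vanishes
    everywhere. *)
Let dil_theta r x v : dil r (theta x v) = theta (dil r x) (dil r v).
Proof.
pose D a := dil r (Theta x v a) - Theta (dil r x) (dil r v) a.
have dD0 : is_derive (0 : R) 1 D 0.
  rewrite -(subrr (dil r v)); apply: is_deriveB; last exact: Theta_derive0.
  exact: is_derive1_dil (Theta_derive0 x v).
have DD a b : D (a + b) = Ad (a *: - dil r x) (D b) + D a.
  rewrite /D (addrC a b) !Theta_add dilD dil_Ad dilZ dilN AdD AdN opprD.
  by rewrite addrACA.
have dD t : is_derive (t : R) 1 D 0.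
  apply: is_derive1_shift; under eq_fun do rewrite DD.
  rewrite -(Adx0 (t *: - dil r x)) -[X in is_derive _ _ _ X]addr0.
  exact: (is_deriveD (Ad_derive _ dD0) (is_derive_cst (D t) (0:R) 1)).
have := is_derive1_0_cst 1 dD; rewrite /D !Theta0 dil0 subr0 => /eqP.
by rewrite subr_eq0 /Theta !scale1r => /eqP.
Qed.

(** Dilations map the left-invariant field of [v] to that of [dil r v]. This is
    the infinitesimal form of the automorphism property of dilations, which transports
    horizontal curves. *)
Lemma dil_X r x v : dil r (X v x) = X (dil r v) (dil r x).
Proof. by rewrite -[in RHS](theta_X x v) dil_theta X_theta. Qed.

End LieTheory.

(** * Uniform estimates for the group law *)

Lemma coord_le_norm (R : realType) n (x : 'rV[R]_n) i : `|x 0 i| <= `|x|.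
Proof.
rewrite [leRHS]/Num.Def.normr /= mx_normrE; apply/bigmax_geP; right => /=.
by exists (0, i).
Qed.

Lemma norm_le_coord (R : realType) n (x : 'rV[R]_n) (a : R) :
  0 <= a -> (forall i, `|x 0 i| <= a) -> `|x| <= a.
Proof.
move=> a0 h; rewrite [leLHS]/Num.Def.normr /= mx_normrE.
apply/bigmax_leP; split=> // -[j i] _ /=.
by rewrite ord1; exact: h.
Qed.

Lemma norm_ball_compact (R : realType) n (r : R) :
  compact [set x : 'rV[R]_n | `|x| <= r].
Proof.
apply: bounded_closed_compact.
  exists r; split; first exact: num_real.
  by move=> M rM x /= xr; exact: le_trans xr (ltW rM).
apply: (@closed_comp _ _ (fun x : 'rV[R]_n => `|x|) [set y | y <= r]).
  by move=> x _; exact: norm_continuous.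
exact: closed_le.
Qed.

Lemma segment_norm_le (R : realType) n (x x' : 'rV[R]_n) (r t : R) :
  0 <= t <= 1 -> `|x| <= r -> `|x'| <= r -> `|x' + t *: (x - x')| <= r.
Proof.
move=> /andP[t0 t1] xr xr'.
have -> : x' + t *: (x - x') = (1 - t) *: x' + t *: x.
  by apply/rowP => i; rewrite !mxE; ring.
apply: le_trans (ler_normD _ _) _; rewrite !normrZ !ger0_norm ?subr_ge0//.
apply: (@le_trans _ _ ((1 - t) * r + t * r)); last by rewrite -mulrDl subrK mul1r.
by apply: lerD; rewrite ler_wpM2l// subr_ge0.
Qed.

Section MulEstimates.
Variables (R : realType) (n s : nat) (G : carnotGroup R n s).
Local Notation V := 'rV[R]_n.
Local Notation "x ** y" := (cg_mul G x y) (at level 40, left associativity).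
Local Notation mulp := (fun p : V * V => p.1 ** p.2).

(** The differential of the group law at [p], in curried form and opaque to
    unification. *)
Fact dmul_sealed : {D : V * V -> V -> V -> V |
  forall p u v, 'd mulp p (u, v) = D p u v}.
Proof. by exists (fun p u v => 'd mulp p (u, v)). Qed.
Definition dmul := sval dmul_sealed.
Lemma dmulE p u v : 'd mulp p (u, v) = dmul p u v.
Proof. exact: (svalP dmul_sealed p u v). Qed.

Lemma dmul_0 u v : dmul (0, 0) u v = u + v.
Proof. by rewrite -dmulE dmul_x0 X_at0. Qed.

Lemma dmulN p u v : dmul p (- u) (- v) = - dmul p u v.
Proof. by rewrite -!dmulE -linearN. Qed.

Lemma dmul_cont u v (p0 : V * V) : dmul p u v @[p --> p0] --> dmul p0 u v.
Proof.
have := differentiable_continuous (@diff_Dmul R n s G (u, v) p0).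
have -> : (fun q => 'd mulp q (u, v)) = (fun p => dmul p u v).
  by apply/funext => q; exact: dmulE.
by move=> h; exact: h.
Qed.

Lemma dmul_expand p (u v : V) : dmul p u v =
  \sum_k u 0 k *: dmul p (delta_mx 0 k) 0 + \sum_k v 0 k *: dmul p 0 (delta_mx 0 k).
Proof.
rewrite -dmulE; under eq_bigr do rewrite -dmulE.
under [X in _ + X]eq_bigr do rewrite -dmulE.
have -> : (u, v) = \sum_k u 0 k *: (delta_mx 0 k, 0) + \sum_k v 0 k *: (0, delta_mx 0 k)
    :> V * V.
  have z0 (z : V) : \sum_(k < n) z 0 k *: (0 : V) = 0.
    by under eq_bigr do rewrite scaler0; rewrite big1_eq.
  apply/pair_equal_spec; split; rewrite /= !raddf_sum/= z0.
    by rewrite addr0; exact: row_sum_delta.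
  by rewrite add0r; exact: row_sum_delta.
rewrite linearD !linear_sum/=.
by congr (_ + _); apply: eq_bigr => k _; rewrite linearZ.
Qed.

(** Smoothness gives the continuity of [p |-> dmul p u v] for each fixed [u] and [v];
    in finite dimension this is continuity for the operator norm. *)
Lemma near_dmul (p0 : V * V) (e : R) : 0 < e -> \forall p \near p0, forall u v : V,
  `|dmul p (u) (v) - dmul p0 (u) (v)| <= e * (`|u| + `|v|).
Proof.
move=> e0.
have e1 : 0 < e / n.+1%:R by rewrite divr_gt0.
have c (u v : V) : \forall p \near p0, `|dmul p u v - dmul p0 u v| < e / n.+1%:R.
  have := @dmul_cont u v p0.
  by move=> /cvgrPdistC_lt /(_ _ e1).
have c1 : \forall p \near p0, forall k : 'I_n,
    `|dmul p (delta_mx 0 k) 0 - dmul p0 (delta_mx 0 k) 0| < e / n.+1%:R.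
  exact: (@filter_forall _ 'I_n (fun k p => `|dmul p (delta_mx 0 k) 0 -
    dmul p0 (delta_mx 0 k) 0| < e / n.+1%:R) _ (nbhs_filter p0) (fun k => c _ _)).
have c2 : \forall p \near p0, forall k : 'I_n,
    `|dmul p 0 (delta_mx 0 k) - dmul p0 0 (delta_mx 0 k)| < e / n.+1%:R.
  exact: (@filter_forall _ 'I_n (fun k p => `|dmul p 0 (delta_mx 0 k) -
    dmul p0 0 (delta_mx 0 k)| < e / n.+1%:R) _ (nbhs_filter p0) (fun k => c _ _)).
near=> p.
have h1 : forall k : 'I_n,
    `|dmul p (delta_mx 0 k) 0 - dmul p0 (delta_mx 0 k) 0| < e / n.+1%:R.
  by near: p; exact: c1.
have h2 : forall k : 'I_n,
    `|dmul p 0 (delta_mx 0 k) - dmul p0 0 (delta_mx 0 k)| < e / n.+1%:R.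
  by near: p; exact: c2.
move=> u v.
have key (z : V) (A : 'I_n -> V) : (forall k, `|A k| < e / n.+1%:R) ->
    `|\sum_k z 0 k *: A k| <= e * `|z|.
  move=> hA; apply: le_trans (ler_norm_sum _ _ _) _.
  apply: (@le_trans _ _ (\sum_(k < n) `|z| * (e / n.+1%:R))).
    apply: ler_sum => k _; rewrite normrZ ler_pM// ?coord_le_norm//.
    exact: ltW.
  have -> : e * `|z| = (`|z| * (e / n.+1%:R)) *+ n.+1.
    by rewrite -mulr_natr -mulrA divfK ?pnatr_eq0// mulrC.
  have q0 : 0 <= `|z| * (e / n.+1%:R) by rewrite mulr_ge0// ltW.
  by rewrite sumr_const card_ord [leRHS]mulrSr lerDl.
rewrite !dmul_expand opprD addrACA -!sumrB mulrDr.
apply: le_trans (ler_normD _ _) _; apply: lerD.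
  by under eq_bigr do rewrite -scalerBr; apply: key => k; exact: h1.
by under eq_bigr do rewrite -scalerBr; apply: key => k; exact: h2.
Unshelve. all: by end_near. Qed.

(** The mean value theorem is applied to one coordinate at a time, so [t] depends on
    [i]; the sup norm makes this harmless. *)
Lemma mvt_mul (x x' y y' : V) i : exists2 t : R, t \in `]0, 1[ &
  (x ** y) 0 i - (x' ** y') 0 i =
  (dmul (x' + t *: (x - x'), y' + t *: (y - y')) (x - x') (y - y')) 0 i.
Proof.
pose f (t : R) : R := ((x' + t *: (x - x')) ** (y' + t *: (y - y'))) 0 i.
have df (t : R) : is_derive t 1 f
    ((dmul (x' + t *: (x - x'), y' + t *: (y - y')) (x - x') (y - y')) 0 i).
  apply: is_derive1_coord; rewrite -dmulE; apply: mul_derive; exact: is_derive1_affine.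
have cf : continuous f.
  move=> t; apply: differentiable_continuous; apply/derivable1_diffP.
  by case: (df t).
have [t t01] := @MVT R f _ 0 1 ltr01 (fun t _ => df t) (continuous_subspaceT cf).
rewrite subr0 mulr1 => h; exists t => //.
by rewrite -h /f !scale0r !scale1r !addr0 ![_ + (_ - _)]addrC !subrK.
Qed.

Lemma dmul_bounded (r : R) : exists2 K : R, 0 <= K & forall x y : V,
  `|x| <= r -> `|y| <= r -> forall u v : V,
  `|dmul (x, y) (u) (v)| <= K * (`|u| + `|v|).
Proof.
have cK := compact_setX (@norm_ball_compact R n r) (@norm_ball_compact R n r).
have /compact_near_coveringP nc := cK.
have := nc R (pinfty_nbhs R) (fun (M : R) p => 0 <= M /\ forall u v : V,
  `|dmul p (u) (v)| <= M * (`|u| + `|v|)) _.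
have H : forall p0 : V * V, (\forall x' \near p0 & i \near +oo, 0 <= i /\
   (forall u v : V, `|dmul x' u v| <= i * (`|u| + `|v|))).
  move=> p0.
  have [M0 M0p hM0] : exists2 M0, 0 <= M0 & forall u v, `|dmul p0 (u) (v)| <= M0 * (`|u| + `|v|).
    pose S := \sum_k `|dmul p0 (delta_mx 0 k) 0| + \sum_k `|dmul p0 0 (delta_mx 0 k)|.
    have S1 : 0 <= \sum_k `|dmul p0 (delta_mx 0 k) 0| by apply: sumr_ge0.
    have S2 : 0 <= \sum_k `|dmul p0 0 (delta_mx 0 k)| by apply: sumr_ge0.
    exists S; first exact: addr_ge0.
    move=> u v; rewrite dmul_expand.
    have key (z : V) (A : 'I_n -> V) : `|\sum_k z 0 k *: A k| <= `|z| * \sum_k `|A k|.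
      apply: le_trans (ler_norm_sum _ _ _) _; rewrite mulr_sumr.
      by apply: ler_sum => k _; rewrite normrZ ler_wpM2r// coord_le_norm.
    apply: le_trans (ler_normD _ _) _.
    apply: le_trans (lerD (key _ _) (key _ _)) _.
    rewrite mulrDr; apply: lerD; rewrite mulrC ler_wpM2r// /S ?lerDl ?lerDr//.
  have h1 := near_dmul p0 ltr01.
  exists ([set p | forall u v : V, `|dmul p (u) (v) - dmul p0 (u) (v)| <=
       1 * (`|u| + `|v|)], [set M | 1 + M0 <= M]).
    by split=> //=; apply: nbhs_pinfty_ge; exact: num_real.
  move=> [p M] /= [hp hM]; split; first by apply: le_trans hM; rewrite addr_ge0.
  move=> u v; rewrite -[X in `|X|](subrK (dmul p0 (u) (v))).
  apply: le_trans (ler_normD _ _) _.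
  apply: (@le_trans _ _ ((1 + M0) * (`|u| + `|v|))).
    by rewrite mulrDl; apply: lerD.
  by rewrite ler_wpM2r ?addr_ge0.
move=> /(_ _ (fun x _ => H x)) h.
have [M hM] := @filter_ex _ (pinfty_nbhs R) _ _ h.
have M0 : 0 <= Num.max 0 M by rewrite le_max lexx.
exists (Num.max 0 M) => // x y xr yr u v.
have [_ /(_ u v) h1] := hM (x, y) (conj xr yr).
by apply: le_trans h1 _; rewrite ler_wpM2r ?addr_ge0// le_max lexx orbT.
Qed.

Lemma mul_lipschitz (r : R) : exists2 K : R, 0 <= K & forall x x' y y' : V,
  `|x| <= r -> `|x'| <= r -> `|y| <= r -> `|y'| <= r ->
  `|x ** y - x' ** y'| <= K * (`|x - x'| + `|y - y'|).
Proof.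
have [K K0 hK] := dmul_bounded r; exists K => // x x' y y' xr xr' yr yr'.
apply: norm_le_coord; first by rewrite mulr_ge0 ?addr_ge0.
move=> i; rewrite !mxE.
have [t t01 ->] := mvt_mul x x' y y' i.
apply: le_trans (coord_le_norm _ _) _; apply: hK.
  apply: segment_norm_le => //; rewrite !ltW ?(itvP t01)//.
apply: segment_norm_le => //; rewrite !ltW ?(itvP t01)//.
Qed.

Lemma mul_strict_diff (e : R) : 0 < e -> exists2 d : R, 0 < d &
  forall x x' y y' : V, `|x| <= d -> `|x'| <= d -> `|y| <= d -> `|y'| <= d ->
  `|x ** y - x' ** y' - (x - x') - (y - y')| <= e * (`|x - x'| + `|y - y'|).
Proof.
move=> e0; have /nbhs_ballP[d /= d0 hd] := near_dmul (0, 0) e0.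
exists (d / 2); first by rewrite divr_gt0.
move=> x x' y y' xd xd' yd yd'.
have dd : d / 2 < d by rewrite ltr_pdivrMr// ltr_pMr// ltr1n.
apply: norm_le_coord; first by rewrite mulr_ge0 ?addr_ge0// ltW.
move=> i.
have [t t01 h] := mvt_mul x x' y y' i.
have -> : (x ** y - x' ** y' - (x - x') - (y - y')) 0 i =
  (dmul (x' + t *: (x - x'), y' + t *: (y - y')) (x - x') (y - y') -
   dmul (0, 0) (x - x') (y - y')) 0 i.
  rewrite dmul_0 [RHS]mxE -h !mxE; ring.
apply: le_trans (coord_le_norm _ _) _; apply: hd.
split; rewrite -ball_normE/= sub0r normrN; apply: le_lt_trans dd;
  apply: segment_norm_le => //; rewrite !ltW ?(itvP t01)//.
Qed.

(** The first-order terms of [b ** k] and [b ** - k] in [k] cancel, and the remainder is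
    uniform over bounded [b] by compactness. *)
Lemma mul_sym_diff (r e : R) : 0 < e -> exists2 d : R, 0 < d &
  forall b k : V, `|b| <= r -> `|k| <= d ->
  `|b ** k + b ** (- k) - 2 *: b| <= e * `|k|.
Proof.
move=> e0.
have e2 : 0 < e / 2 by rewrite divr_gt0.
(* [P k b] bounds the oscillation of the differential on the segment
   from [(b, - k)] to [(b, k)], which the mean value theorem needs at two points. *)
have /compact_near_coveringP nc := @norm_ball_compact R n r.
pose P (k b : V) := forall t t' : R, -1 <= t <= 1 -> -1 <= t' <= 1 -> forall v,
    `|dmul (b, t *: k) 0 v - dmul (b, t' *: k) 0 v| <= e * `|v|.
have H (b0 : V) : \forall b \near b0 & k \near (0 : V), P k b.
  have /nbhs_ballP[d /= d0 hd] := near_dmul (b0, 0) e2.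
  exists (ball b0 d, ball 0 d); first by split; exact: nbhsx_ballx.
  move=> [b k] /= [hb hk] t t' t1 t1' v.
  have hd' c : -1 <= c <= 1 -> `|dmul (b, c *: k) 0 v - dmul (b0, 0) 0 v| <= e / 2 * `|v|.
    move=> /andP[c0 c1].
    suff /hd/(_ 0 v) : ball (b0, 0) d (b, c *: k) by rewrite normr0 add0r.
    split=> //=.
    move: hk; rewrite -!ball_normE /= !sub0r !normrN => hk.
    by apply: le_lt_trans hk; rewrite normrZ ler_piMl// ler_norml c0.
  rewrite -(subrK (dmul (b0, 0) 0 v) (dmul (b, t *: k) 0 v)) -addrA.
  rewrite [e](splitr e) mulrDl; apply: le_trans (ler_normD _ _) _.
  by apply: lerD; [exact: hd'|rewrite distrC; exact: hd'].
have hP : \forall k \near (0 : V), [set x | `|x| <= r] `<=` P k.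
  by apply: (nc V (nbhs (0 : V)) P (nbhs_filter _)) => b _; exact: H.
have /nbhs_ballP[d /= d0 hd] := hP.
exists (d / 2); first by rewrite divr_gt0.
move=> b k br kd.
have dd : d / 2 < d by rewrite ltr_pdivrMr// ltr_pMr// ltr1n.
apply: norm_le_coord; first by rewrite mulr_ge0// ltW.
move=> i.
have [t t01 h] := mvt_mul b b k 0 i.
have [t' t01' h'] := mvt_mul b b (- k) 0 i.
rewrite (cg_mulx0 G) subrr scaler0 addr0 subr0 add0r in h.
rewrite (cg_mulx0 G) subrr scaler0 addr0 subr0 add0r in h'.
have e1 : dmul (b, t' *: - k) 0 (- k) = - dmul (b, (- t') *: k) 0 k.
  by rewrite -[X in dmul _ X _]oppr0 dmulN scalerN scaleNr.
have -> : (b ** k + b ** - k - 2 *: b) 0 i =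
    (dmul (b, t *: k) 0 k - dmul (b, (- t') *: k) 0 k) 0 i.
  by rewrite -e1 [RHS]mxE -h -h' !mxE; ring.
apply: le_trans (coord_le_norm _ _) _.
apply: (hd k) => //.
- by rewrite -ball_normE/= sub0r normrN; exact: le_lt_trans dd.
- by rewrite (le_trans (lerN10 _)) ?ltW ?(itvP t01).
- by rewrite lerN2 lerNl (le_trans (lerN10 _)) ?ltW ?(itvP t01').
Qed.

End MulEstimates.

(** * Products of horizontal elements fill a neighbourhood of the identity *)

(** A minimizer [t] of [|F t - x|] on the ball is a solution: otherwise the step
    [x - F t], which stays in the ball, would halve the distance to [x]. *)
Lemma quasi_identity_surj (R : realType) n (F : 'rV[R]_n -> 'rV[R]_n) (d : R) :
  0 < d -> F 0 = 0 -> continuous F ->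
  (forall t t', `|t| <= d -> `|t'| <= d ->
     `|F t - F t' - (t - t')| <= 2^-1 * `|t - t'|) ->
  forall x, `|x| <= d / 8 -> exists2 t, `|t| <= d & F t = x.
Proof.
move=> d0 F0 cF hF x xd.
pose A := [set t : 'rV[R]_n | `|t| <= d].
have A0 : A 0 by rewrite /A/= normr0 ltW.
have cg : {within A, continuous (fun t => `|F t - x|)}.
  apply: continuous_subspaceT => t.
  apply: (@continuous_comp _ _ _ (fun t => F t - x) (fun y : 'rV[R]_n => `|y|)).
    by apply: (@continuousB _ _ _ F (fun=> x)); [exact: (cF t)|exact: cst_continuous].
  exact: norm_continuous.
have [t tA tmin] := @EVT_min_rV R n _ A (ex_intro _ 0 A0) (@norm_ball_compact R n d) cg.
move: tA; rewrite inE /A/= => tA.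
exists t => //; apply/eqP; apply: contrapT => /negP Ft.
have h0 : `|F t - x| <= `|x|.
  have := tmin 0; rewrite inE F0 sub0r normrN; exact.
(* The bound [d / 8] on [x] leaves room for the step: [|t| <= d / 2]. *)
have h1 : `|t| <= d / 2.
  have := hF t 0 tA; rewrite normr0 F0 !subr0 => /(_ (ltW d0)) h.
  have h2 : `|t| <= `|F t - t| + `|F t - x| + `|x|.
    rewrite -[X in `|X|](_ : - (F t - t) + ((F t - x) + x) = t); last first.
      by rewrite subrK opprB subrK.
    apply: le_trans (ler_normD _ _) _; rewrite normrN -[leRHS]addrA lerD2l.
    exact: ler_normD.
  by lra.
pose e := x - F t.
have e0 : 0 < `|e| by rewrite normr_gt0 subr_eq0 eq_sym.
have he : `|e| = `|F t - x| by rewrite distrC.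
have te : `|t + e| <= d.
  by apply: le_trans (ler_normD _ _) _; lra.
have h3 := hF (t + e) t te tA.
have h4 := tmin (t + e); rewrite inE in h4; have {}h4 := h4 te.
have te' : t + e - t = e by rewrite addrAC subrr add0r.
rewrite te' in h3.
have h5 : F (t + e) - F t - e = F (t + e) - x.
  by rewrite /e opprB addrA subrK.
by rewrite h5 in h3; lra.
Qed.

Lemma is_derive1_mulmx (R : realType) n m (C : 'M[R]_(n, m)) (p : R -> 'rV[R]_n) (t : R) v :
  is_derive t 1 p v -> is_derive t 1 (fun u => p u *m C) (v *m C).
Proof.
move=> dp; apply: is_derive1_coords => k; rewrite mxE.
have -> : (fun a : R => (p a *m C) 0 k) = \sum_j (fun a => p a 0 j *: C j k).
  by apply/funext => a; rewrite fct_sumE mxE.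
apply: is_derive_sum => j.
exact: is_derive1_Zl (is_derive1_coord j dp).
Qed.

Section Chow.
Variables (R : realType) (n s : nat) (G : carnotGroup R n s).
Local Notation V := 'rV[R]_n.
Local Notation "x ** y" := (cg_mul G x y) (at level 40, left associativity).
Local Notation mulp := (fun p : V * V => p.1 ** p.2).
Local Notation wt := (cg_weight G).
Local Notation layer := (@layer_of R n wt).
Local Notation Ad := (Ad G).
Local Notation bracket := (bracket G).

(** A product of horizontal elements is the end point of a horizontal curve that
    follows one flow line per factor. The number and the size of the factors, which
    [hreach] keeps track of, bound its length. *)
Definition word (l : seq V) : V := foldr (cg_mul G) 0 l.

Definition hreach (N : nat) (B : R) (x : V) := exists l : seq V,
  [/\ (size l <= N)%N, forall v, v \in l -> layer 1 v /\ `|v| <= B & word l = x].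

Lemma word_cat l1 l2 : word (l1 ++ l2) = word l1 ** word l2.
Proof.
elim: l1 => [|v l IH] /=; first by rewrite (cg_mul0x G).
by rewrite IH (cg_mulA G).
Qed.

Lemma hreachW N N' B B' x : (N <= N')%N -> B <= B' -> hreach N B x -> hreach N' B' x.
Proof.
move=> NN BB [l [sl hl <-]]; exists l; split=> //; first exact: leq_trans NN.
by move=> v /hl[h1 h2]; split=> //; exact: le_trans BB.
Qed.

Lemma hreachM N N' B x y : hreach N B x -> hreach N' B y -> hreach (N + N') B (x ** y).
Proof.
move=> [l [sl hl <-]] [l' [sl' hl' <-]]; exists (l ++ l'); split.
- by rewrite size_cat leq_add.
- by move=> v; rewrite mem_cat => /orP[/hl|/hl'].
- exact: word_cat.
Qed.

Lemma hreachN N B x : hreach N B x -> hreach N B (- x).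
Proof.
move=> [l [sl hl <-]]; exists (rev [seq - v | v <- l]); split.
- by rewrite size_rev size_map.
- move=> v; rewrite mem_rev => /mapP[u /hl[h1 h2] ->]; rewrite normrN; split=> //.
  by rewrite -scaleN1r; exact: layerZ.
- elim: l {sl hl} => [|v l IH] /=; first by rewrite oppr0.
  by rewrite rev_cons -cats1 word_cat IH /= (cg_mulx0 G) oppM.
Qed.

Lemma hreach1 v : layer 1 v -> hreach 1 `|v| v.
Proof.
move=> hv; exists [:: v]; split=> //=; last by rewrite (cg_mulx0 G).
by move=> u; rewrite inE => /eqP ->.
Qed.

Lemma hreach0 N B : hreach N B 0.
Proof. by exists [::]. Qed.

(** The elements [t (Ad h v) = h (t v) h^-1] are products of horizontal elements,
    boundedly many for [|t| <= 1] ([hconj_line]): unlike commutators, they give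
    genuine lines in non-horizontal directions. *)
Definition hconj (z : V) := exists h v, [/\ exists N B, hreach N B h, layer 1 v & z = Ad h v].

Lemma hconjZ a z : hconj z -> hconj (a *: z).
Proof.
by move=> [h [v [hh hv ->]]]; exists h, (a *: v); split=> //; [exact: layerZ|rewrite AdZ].
Qed.

Lemma hconj_line z : hconj z -> exists N B, forall t : R, `|t| <= 1 -> hreach N B (t *: z).
Proof.
move=> [h [v [[N [B hh]] hv ->]]].
exists (N + 1 + N)%N, (Num.max B `|v|) => t t1.
rewrite -AdZ; have hB : hreach N (Num.max B `|v|) h by apply: hreachW hh; rewrite // le_max lexx.
apply: hreachM; last exact: hreachN.
apply: hreachM => //.
apply: hreachW (hreach1 (layerZ t hv)) => //.
by rewrite normrZ le_max ler_piMl ?orbT.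
Qed.

Lemma hconj_Ad a z : layer 1 a -> hconj z -> hconj (Ad a z).
Proof.
move=> ha [h [v [[N [B hh]] hv ->]]]; exists (a ** h), v; split=> //; last by rewrite AdM.
exists (1 + N)%N, (Num.max `|a| B); apply: hreachM.
  by apply: hreachW (hreach1 ha); rewrite // le_max lexx.
by apply: hreachW hh; rewrite // le_max lexx orbT.
Qed.

Lemma hconj_layer1 v : layer 1 v -> hconj v.
Proof.
move=> hv; exists 0, v; split=> //; last by rewrite Ad0x.
by exists 0%N, 0; exact: hreach0.
Qed.

(** Take a family of conjugates of horizontal elements of maximal rank. Its span is
    stable under [Ad a] for horizontal [a], hence, differentiating, under brackets with
    the first layer; as it contains that layer, it contains all of them. *)
Lemma hconj_span (x : V) : exists2 zs : seq V, (forall z, z \in zs -> hconj z) &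
  \sum_(z <- zs) z = x.
Proof.
pose Q m := `[< exists k (A : 'M[R]_(k, n)), (forall i, hconj (row i A)) /\ \rank A = m >].
have Q0 : exists m, Q m.
  exists 0%N; apply/asboolP; exists 0%N, 0; split; first by case.
  by rewrite mxrank0.
have Qn m : Q m -> (m <= n)%N.
  by move=> /asboolP[k [A [_ <-]]]; exact: rank_leq_col.
have [m /asboolP[k [A [hA rA]]] mmax] := ex_maxnP Q0 Qn.
(* A conjugate outside the span would raise the rank. *)
have hS z : hconj z -> (z <= A)%MS.
  move=> hz; apply: contrapT => /negP zA.
  have : Q (\rank (col_mx A z)).
    apply/asboolP; exists (k + 1)%N, (col_mx A z); split=> // i.
    case: (split_ordP i) => j ->; first by rewrite rowKu.
    by rewrite rowKd ord1 row_id.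
  move=> /mmax; rewrite leqNgt -rA -addsmxE => /negP; apply.
  rewrite ltn_neqAle mxrankS ?addsmxSl// andbT.
  apply: contra zA => /eqP/esym e.
  have : (A + z <= A)%MS by rewrite -(geq_leqif (mxrank_leqif_sup (addsmxSl A z))) e.
  by rewrite addsmx_sub => /andP[].
have hAd a z : layer 1 a -> (z <= A)%MS -> (Ad a z <= A)%MS.
  move=> ha /submxP[D ->]; rewrite mulmx_sum_row.
  have -> : Ad a (\sum_i D 0 i *: row i A) = \sum_i D 0 i *: Ad a (row i A).
    rewrite (big_morph (Ad a) (AdD G a) (Adx0 G a)).
    by apply: eq_bigr => i _; rewrite AdZ.
  apply: summx_sub => i _; apply: scalemx_sub; apply: hS.
  exact: hconj_Ad.
(* Membership in the row space of [A] is the linear equation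
   [z *m cokermx A = 0], which passes to derivatives. *)
have hbr a z : layer 1 a -> (z <= A)%MS -> (bracket a z <= A)%MS.
  move=> ha hz; rewrite submxE; apply/eqP.
  have := is_derive1_mulmx (cokermx A) (bracket_derive0 G a z).
  move=> /is_derive1_unique; apply.
  have -> : (fun u : R => Ad (u *: a) z *m cokermx A) = (fun=> 0).
    apply/funext => u; apply/eqP; rewrite -submxE; apply: hAd => //.
    exact: layerZ.
  exact: is_derive_cst.
have hl i : (i < s)%N -> forall z, layer i.+1 z -> (z <= A)%MS.
  elim: i => [|i IH] is_ z; first by move=> /hconj_layer1/hS.
  have i1 : (0 < i.+1 < s)%N by [].
  rewrite -(cg_layer_step G i1) => -[l [c [a [ha ->]]]].
  apply: summx_sub => j _; apply: scalemx_sub.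
  have [u hu [v hv <-]] := ha j; rewrite bracketE; apply: hbr => //.
  by apply: IH => //; exact: ltnW.
have /submxP[D xD] : (x <= A)%MS.
  rewrite (row_sum_delta x); apply: summx_sub => j _; apply: scalemx_sub.
  have /andP[w0 ws] := cg_weight_bounds G j.
  by apply: (hl (wt j).-1); rewrite prednK//; exact: layer_basis.
exists [seq D 0 i *: row i A | i <- enum 'I_k].
  by move=> z /mapP[i _ ->]; exact: hconjZ.
by rewrite big_map big_enum/= xD mulmx_sum_row.
Qed.

(** One coordinate of [t] may drive several factors, since a basis vector is only a sum
    of conjugates of horizontal elements; [pathlin] is the differential at [0]. *)
Definition pathprod (L : seq ('I_n * V)) (t : V) : V :=
  foldr (fun p acc => (t 0 p.1 *: p.2) ** acc) 0 L.

Lemma pathprod_reach L : (forall p, p \in L -> hconj p.2) ->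
  exists N B, forall t : V, `|t| <= 1 -> hreach N B (pathprod L t).
Proof.
elim: L => [|[j z] L IH] hL.
  by exists 0%N, 0 => t _; exact: hreach0.
have [N [B h1]] := IH (fun p pL => hL p (mem_behead (s := _ :: _) pL)).
have [N' [B' h2]] := hconj_line (hL (j, z) (mem_head _ _)).
exists (N' + N)%N, (Num.max B' B) => t t1 /=.
apply: hreachM.
  apply: hreachW (h2 _ _) => //; first by rewrite le_max lexx.
  exact: le_trans (coord_le_norm _ _) t1.
by apply: hreachW (h1 _ t1); rewrite // le_max lexx orbT.
Qed.

Lemma pathprod_diff L t : differentiable (pathprod L) t.
Proof.
elim: L => [|[j z] L IH]; first exact: differentiable_cst.
have -> : pathprod ((j, z) :: L) = mulp \o (fun t : V => (t 0 j *: z, pathprod L t)) by [].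
apply: differentiable_comp; last exact: diff_mul.
apply: differentiable_pair; last exact: IH.
have -> : (fun t : V => t 0 j *: z) = ( *:%R^~ z) \o (fun t : V => t 0 j : R) by [].
by apply: differentiable_comp; first exact: differentiable_coord.
Qed.

Lemma pathprod_cont L : continuous (pathprod L).
Proof. by move=> t; apply: differentiable_continuous; exact: pathprod_diff. Qed.

Lemma pathprod0 L : pathprod L 0 = 0.
Proof. by elim: L => //= -[j z] L IH; rewrite IH mxE scale0r (cg_mul0x G). Qed.

Definition pathlin (L : seq ('I_n * V)) (t : V) : V := \sum_(p <- L) t 0 p.1 *: p.2.

(** Strict differentiability at [0], by induction on the number of factors. *)
Lemma pathprod_strict L (e : R) : 0 < e -> exists2 d : R, 0 < d &
  forall t t' : V, `|t| <= d -> `|t'| <= d ->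
  `|pathprod L t - pathprod L t' - pathlin L (t - t')| <= e * `|t - t'|.
Proof.
elim: L e => [|[j z] L IH] e e0.
  exists 1 => // t t' _ _; rewrite /pathlin big_nil /= !subr0 normr0 mulr_ge0//.
  exact: ltW.
pose C := \sum_(p <- L) `|p.2|.
have C0 : 0 <= C by apply: sumr_ge0.
have lin t : `|pathlin L t| <= C * `|t|.
  rewrite /pathlin; apply: le_trans (ler_norm_sum _ _ _) _.
  rewrite /C mulr_suml; apply: ler_sum => p _; rewrite normrZ mulrC ler_wpM2l//.
  exact: coord_le_norm.
have D0 : 0 < `|z| + C + 1 by rewrite ltr_wpDl// addr_ge0.
have e1 : 0 < e / 2 / (`|z| + C + 1) by rewrite !divr_gt0.
have [d1 d10 h1] := mul_strict_diff G e1.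
have [|d2 d20 h2] := IH (Num.min 1 (e / 2)); first by rewrite lt_min ltr01 divr_gt0.
have lip t t' : `|t| <= d2 -> `|t'| <= d2 -> `|pathprod L t - pathprod L t'| <= (C + 1) * `|t - t'|.
  move=> td td'; rewrite -(subrK (pathlin L (t - t')) (pathprod L t - pathprod L t')).
  apply: le_trans (ler_normD _ _) _; rewrite addrC mulrDl; apply: lerD => //.
  apply: le_trans (h2 _ _ td td') _; rewrite ler_wpM2r// ge_min lexx.
  by [].
exists (Num.min d2 (d1 / (`|z| + C + 1))); first by rewrite lt_min d20 divr_gt0.
move=> t t'; rewrite !le_min => /andP[td2 td1] /andP[td2' td1'].
have bz (u : V) : `|u| <= d1 / (`|z| + C + 1) -> `|u 0 j *: z| <= d1.
  rewrite ler_pdivlMr// => h; apply: le_trans h; rewrite normrZ.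
  by rewrite ler_pM// ?coord_le_norm// -addrA lerDl addr_ge0.
have bp (u : V) : `|u| <= d2 -> `|u| <= d1 / (`|z| + C + 1) -> `|pathprod L u| <= d1.
  move=> ud2; rewrite ler_pdivlMr// => h; apply: le_trans h.
  have := lip u 0 ud2; rewrite normr0 pathprod0 !subr0 => /(_ (ltW d20)) h.
  by apply: le_trans h _; rewrite mulrC ler_wpM2l// -addrA lerDr.
have := h1 _ _ _ _ (bz _ td1) (bz _ td1') (bp _ td2 td1) (bp _ td2' td1').
rewrite -scalerBl => k1.
have k2 := h2 _ _ td2 td2'; have k3 := lip _ _ td2 td2'.
have k4 : `|(t 0 j - t' 0 j) *: z| <= `|z| * `|t - t'|.
  rewrite normrZ mulrC ler_wpM2l//.
  by have := coord_le_norm (t - t') j; rewrite !mxE.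
have -> : pathprod ((j, z) :: L) t - pathprod ((j, z) :: L) t' - pathlin ((j, z) :: L) (t - t') =
  ((t 0 j *: z) ** pathprod L t - (t' 0 j *: z) ** pathprod L t' -
   (t 0 j - t' 0 j) *: z - (pathprod L t - pathprod L t')) +
  (pathprod L t - pathprod L t' - pathlin L (t - t')).
  rewrite /pathlin big_cons /= [in LHS]opprD addrA.
  have -> : (t - t') 0 j = t 0 j - t' 0 j by rewrite !mxE.
  by rewrite subrKA.
apply: le_trans (ler_normD _ _) _; rewrite [e]splitr mulrDl; apply: lerD.
  apply: le_trans k1 _.
  apply: (@le_trans _ _ (e / 2 / (`|z| + C + 1) * ((`|z| + C + 1) * `|t - t'|))); last first.
    by rewrite mulrA divfK// gt_eqF.
  apply: ler_wpM2l; first exact: ltW.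
  by rewrite -addrA mulrDl; exact: lerD.
by apply: le_trans k2 _; rewrite ler_wpM2r// ge_min lexx orbT.
Qed.

(** The map [pathprod L], for [L] listing decompositions of the basis vectors, has
    differential the identity at [0], so [quasi_identity_surj] applies: this is Chow's
    theorem near the identity. *)
Lemma hreach_nbhs : exists N B (r : R), 0 < r /\ forall x, `|x| <= r -> hreach N B x.
Proof.
have hz j := hconj_span (delta_mx 0 j).
pose zs j := projT1 (cid2 (hz j)).
have zs1 j : forall z, z \in zs j -> hconj z by rewrite /zs; case: cid2.
have zs2 j : \sum_(z <- zs j) z = delta_mx 0 j by rewrite /zs; case: cid2.
pose L := [seq (j, z) | j <- enum 'I_n, z <- zs j].
have L1 p : p \in L -> hconj p.2.
  by move=> /allpairsPdep[j [z [_ zj ->]]] /=; exact: zs1 zj.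
have L2 t : pathlin L t = t.
  rewrite /pathlin /L big_allpairs_dep/= [RHS]row_sum_delta big_enum/=.
  by apply: eq_bigr => j _; rewrite -scaler_sumr zs2.
have [N [B hNB]] := pathprod_reach L1.
have [|d d0 hd] := @pathprod_strict L 2^-1; first by rewrite invr_gt0.
pose d' := Num.min d 1.
have d'0 : 0 < d' by rewrite lt_min d0 ltr01.
exists N, B, (d' / 8); split; first by rewrite divr_gt0.
move=> x xd.
have hd' t t' : `|t| <= d' -> `|t'| <= d' ->
    `|pathprod L t - pathprod L t' - (t - t')| <= 2^-1 * `|t - t'|.
  rewrite !le_min => /andP[td _] /andP[td' _].
  by have := hd t t' td td'; rewrite L2.
have [t td <-] := quasi_identity_surj d'0 (pathprod0 L) (@pathprod_cont L) hd' xd.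
by apply: hNB; move: td; rewrite le_min => /andP[].
Qed.

End Chow.

(** * Increments of absolutely continuous functions *)

(** Induction along a compact interval. The step goes from the left of [x] to its right
    in one move, as an extension of covers or of estimates across [x] requires. *)
Lemma creeping_principle (R : realType) (a b : R) (P : R -> Prop) : a <= b -> P a ->
  (forall x, a <= x <= b -> exists2 d : R, 0 < d & forall t t',
     a <= t -> t <= x -> x <= t' -> t' <= b -> x - d < t -> t' < x + d -> P t -> P t') ->
  P b.
Proof.
move=> ab Pa step.
pose S := [set t | a <= t <= b /\ P t].
have Sa : S a by split; rewrite // lexx.
have hS : has_sup S.
  by split; [exists a|exists b => t [/andP[_ tb] _]].
pose c := sup S.
have ac : a <= c by exact: (ub_le_sup hS.2 Sa).
have cb : c <= b by apply: ge_sup; [exists a|move=> t [/andP[_ tb] _]].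
have cab : a <= c <= b by rewrite ac cb.
have [d d0 hd] := step c cab.
have [t St ct] := sup_adherent d0 hS.
have tc : t <= c by exact: (ub_le_sup hS.2 St).
have [/andP[at_ tb] Pt] := St.
pose t' := Num.min b (c + d / 2).
have ct' : c <= t' by rewrite le_min cb lerDl divr_ge0// ltW.
have t'b : t' <= b by rewrite ge_min lexx.
have t'd : t' < c + d.
  by rewrite gt_min ltrD2l ltr_pdivrMr// ltr_pMr// ltr1n orbT.
have Pt' := hd t t' at_ tc ct' t'b ct t'd Pt.
have t'c : t' <= c.
  by apply: (ub_le_sup hS.2); split; rewrite // t'b (le_trans ac).
suff -> : b = t' by [].
apply/eqP; rewrite eq_le t'b andbT leNgt; apply/negP => t'_b.
move: t'c; rewrite /t' ge_min => /orP[bc|].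
  by have := lt_le_trans t'_b bc; rewrite ltNge ct'.
by rewrite gerDl leNgt divr_gt0.
Qed.

(** Same notion as [abs_continuous], for an arbitrary normed codomain. *)
Definition ac (R : realType) (W : normedModType R) (a b : R) (f : R -> W) := forall e : R, 0 < e ->
  exists2 d : R, 0 < d & forall (k : nat) (p q : 'I_k -> R),
    (forall i, a <= p i /\ p i <= q i /\ q i <= b) ->
    trivIset setT (fun i => [set` `]p i, q i[ ]) ->
    \sum_i (q i - p i) < d -> \sum_i `|f (q i) - f (p i)| < e.

(** On the null set [N] of bad times absolute continuity takes over. Cover [N] and the
    two end points by an open set [U] of measure less than [d], and creep from [a] to
    [b]: near a good time the increment of [f] is at most that of [F] up to [2 e] times the
    length, near a bad time an interval inside [U] is added to a finite list. The total
    length of the list is less than [d], so it contributes less than [e]. *)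
Lemma ac_increment_le (R : realType) (a b : R) (f F : R -> R) (N : set R) :
  a <= b -> ac a b f -> {in `[a, b] &, {homo F : x y / x <= y}} ->
  measurable N -> lebesgue_measure N = 0%E ->
  (forall t, t \in `]a, b[ -> ~ N t -> exists k : R, forall e : R, 0 < e ->
     \forall h \near (0 : R), `|f (t + h) - f t| <= (k + e) * `|h| /\
       `|F (t + h) - F t - k * h| <= e * `|h|) ->
  `|f b - f a| <= F b - F a.
Proof.
move=> ab acf Fmon mN N0 hd.
apply/ler_addgt0Pr => e0 e0p.
pose e := e0 / (2 * (b - a) + 1).
have ba : 0 <= b - a by rewrite subr_ge0.
have den : 0 < 2 * (b - a) + 1 by rewrite ltr_wpDl// mulr_ge0.
have e_gt0 : 0 < e by rewrite divr_gt0.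
have [d d0 hac] := acf e e_gt0.
pose N' := N `|` [set a] `|` [set b].
have mN' : measurable N' by apply: measurableU; [apply: measurableU|].
have N'0 : lebesgue_measure N' = 0%E.
  have : lebesgue_measure.-negligible (N' : set R).
    apply: negligibleU; first apply: negligibleU.
    - by apply/negligibleP.
    - by apply/negligibleP => //; exact: lebesgue_measure_set1.
    - by apply/negligibleP => //; exact: lebesgue_measure_set1.
  by move/negligibleP; apply.
have N'fin : (lebesgue_measure (N' : set R) < +oo)%E by rewrite N'0 ltry.
have [U [oU NU muU]] := lebesgue_regularity_outer mN' N'fin d0.
have mU : measurable U by exact: measurable_realfun.open_measurable.
have mUt t : measurable (U `&` `[a, t]) by exact: measurableI.
have {}muU : (lebesgue_measure U < d%:E)%E.
  rewrite (measureDI lebesgue_measure mU mN').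
  rewrite [X in (_ + X)%E](_ : _ = 0%E); first by rewrite adde0.
  apply/eqP; rewrite eq_le measure_ge0 andbT -[leRHS]N'0.
  by apply: le_measure; rewrite ?inE//; exact: measurableI.
pose P t := exists (k : nat) (p q : nat -> R),
  [/\ (forall i, (i < k)%N -> a <= p i /\ p i <= q i /\ q i <= t),
   (forall i j, (i < j)%N -> (j < k)%N -> q i <= p j),
   ((\sum_(i < k) (q i - p i))%:E <= lebesgue_measure (U `&` `[a, t]))%E &
   `|f t - f a| <= F t - F a + 2 * e * (t - a) + \sum_(i < k) `|f (q i) - f (p i)| ].
have : P b.
  apply: (creeping_principle ab).
    exists 0%N, (fun=> 0), (fun=> 0); split => //; first by rewrite big_ord0.
    by rewrite big_ord0 !subrr normr0 mulr0 !addr0.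
  move=> x /andP[ax xb].
  have [N'x|N'x] := pselect (N' x).
    have /nbhs_ballP[r /= r0 hr] : nbhs x U by apply: open_nbhs_nbhs; split => //; exact: NU.
    exists r => // t t' at_ tx xt' t'b rt rt' [k [p [q [h1 h2 h3 h4]]]].
    have tt' : t <= t' by exact: le_trans xt'.
    exists k.+1, (fun i => if (i == k)%N then t else p i),
      (fun i => if (i == k)%N then t' else q i).
    split.
    - move=> i; rewrite ltnS leq_eqVlt; case: eqVneq => [_|_ /= ik]; first by [].
      have [? [? qt]] := h1 i ik; split=> //; split=> //; exact: le_trans tt'.
    - move=> i j ij; rewrite ltnS => jk.
      rewrite (_ : (i == k)%N = false); last by apply: ltn_eqF; exact: leq_trans jk.
      move: jk; rewrite leq_eqVlt; case: eqVneq => [jk _|_ /= jk]; last exact: h2.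
      by have [_ [_]] := h1 i (leq_trans ij (eq_leq jk)).
    - rewrite big_ord_recr/= eqxx.
      under eq_bigr => i _ do rewrite ltn_eqF//.
      rewrite EFinD; apply: (@le_trans _ _ (lebesgue_measure (U `&` `[a, t]) +
          lebesgue_measure (`]t, t'] : set R))%E).
        apply: leeD => //; rewrite lebesgue_measure_itv/= lte_fin.
        case: ltP => // t't; rewrite (_ : t = t') ?subrr//.
        by apply/eqP; rewrite eq_le tt'.
      rewrite -measureU//; [|exact: mUt|].
        apply: le_measure.
        - by rewrite inE; apply: measurableU => //; exact: mUt.
        - by rewrite inE; exact: mUt.
        move=> y [[Uy]|] /=; rewrite !in_itv/= => /andP[h5 h6].
          by split=> //; rewrite h5 (le_trans h6).
        split; last by rewrite h6 andbT ltW// (le_lt_trans at_).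
        apply: hr; rewrite -ball_normE/= ltr_distlC.
        by rewrite (lt_trans rt h5) (le_lt_trans h6).
      apply/seteqP; split=> // y [[_]] /=; rewrite !in_itv/= => /andP[_ yt] /andP[ty _].
      by move: ty; rewrite ltNge yt.
    - rewrite big_ord_recr/= eqxx.
      under eq_bigr => i _ do rewrite ltn_eqF//.
      have h5 : F t <= F t'.
        by apply: Fmon; rewrite ?in_itv/= ?at_ ?t'b ?(le_trans tt')// (le_trans at_).
      have h6 : 2 * e * (t - a) <= 2 * e * (t' - a).
        by rewrite ler_wpM2l ?lerB// mulr_ge0// ltW.
      have h7 : `|f t' - f a| <= `|f t' - f t| + `|f t - f a|.
        by rewrite (le_trans _ (ler_normD _ _))// subrKA.
      by move: h4 h5 h6 h7; lra.
  have xab : x \in `]a, b[.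
    rewrite in_itv/= !lt_neqAle ax xb !andbT; apply/andP; split.
      by apply/eqP => e1; apply: N'x; left; right; rewrite /= e1.
    by apply/eqP => e1; apply: N'x; right; rewrite /= e1.
  have Nx : ~ N x by move=> Nx; apply: N'x; left; left.
  have [k hk] := hd x xab Nx.
  have /nbhs_ballP[r /= r0 hr] := hk e e_gt0.
  exists r => // t t' at_ tx xt' t'b rt rt' [m [p [q [h1 h2 h3 h4]]]].
  have tt' : t <= t' by exact: le_trans xt'.
  exists m, p, q; split => //.
  - move=> i im; have [? [? qt]] := h1 i im; split=> //; split=> //; exact: le_trans tt'.
  - apply: le_trans h3 _; apply: le_measure; rewrite ?inE; [exact: mUt|exact: mUt|].
    move=> y [Uy] /=.
    by rewrite !in_itv/= => /andP[ay yt]; split=> //; rewrite ay (le_trans yt).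
  - have b1 : ball 0 r (t' - x).
      by rewrite -ball_normE/= sub0r normrN ger0_norm ?subr_ge0// ltrBlDl.
    have b2 : ball 0 r (t - x).
      rewrite -ball_normE/= sub0r normrN ler0_norm ?subr_le0// opprB.
      by rewrite ltrBlDr addrC -ltrBlDr.
    have [g1 g2] := hr _ b1; have [g3 g4] := hr _ b2.
    rewrite (addrC x) subrK in g1 g2; rewrite (addrC x) subrK in g3 g4.
    have n1 : `|t' - x| = t' - x by rewrite ger0_norm ?subr_ge0.
    have n2 : `|t - x| = x - t by rewrite ler0_norm ?subr_le0// opprB.
    rewrite n1 in g1 g2; rewrite n2 in g3 g4.
    have h7 : `|f t' - f a| <= `|f t' - f x| + `|f t - f x| + `|f t - f a|.
      rewrite (distrC (f t) (f x)) (le_trans _ (lerD (ler_normD _ _) (lexx _)))// subrKA.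
      by rewrite (le_trans _ (ler_normD _ _))// subrKA.
    rewrite ler_norml in g2; rewrite ler_norml in g4.
    move: g2 g4 => /andP[g2 _] /andP[g4 g5].
    by move: h4 h7 g1 g2 g3 g4 g5; lra.
move=> [k [p [q [h1 h2 h3 h4]]]].
have h5 : \sum_(i < k) `|f (q i) - f (p i)| < e.
  apply: hac => [i||].
  - by have [? [? ?]] := h1 i (ltn_ord i).
  - move=> i j _ _ [y []] /=; rewrite !in_itv/= => /andP[pi iq] /andP[pj jq].
    apply/val_inj; case: (ltngtP i j) => // ij.
      by have := lt_le_trans iq (h2 _ _ ij (ltn_ord j)); rewrite ltNge ltW.
    by have := lt_le_trans jq (h2 _ _ ij (ltn_ord i)); rewrite ltNge ltW.
  - rewrite -lte_fin; apply: le_lt_trans h3 _; apply: le_lt_trans muU.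
    by apply: le_measure; rewrite ?inE//; exact: mUt.
have h6 : e * (2 * (b - a) + 1) = e0 by rewrite /e divfK// gt_eqF.
by move: h4 h5 h6; lra.
Qed.

Lemma is_derive1_near (R : realType) (W : normedModType R) (f : R -> W) (t : R) (df : W) :
  is_derive t 1 f df -> forall e : R, 0 < e ->
  \forall h \near (0 : R), `|f (t + h) - f t - h *: df| <= e * `|h|.
Proof.
move=> [/cvg_ex[l hl] fE] e e0.
have ldf : l = df by rewrite -fE /derive (cvg_lim _ hl).
move/cvgrPdist_le : hl => /(_ _ e0); rewrite ldf near_withinE; apply: filterS => h.
have [->|h0] := eqVneq h 0.
  by move=> _; rewrite addr0 subrr scale0r subrr !normr0 mulr0.
move=> /(_ isT); rewrite /= [h%:A]mulr1 [h + t]addrC => he.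
have -> : f (t + h) - f t - h *: df = - (h *: (df - h^-1 *: (f (t + h) - f t))).
  by rewrite scalerBr scalerA divff// scale1r opprB.
by rewrite normrN normrZ mulrC ler_wpM2r.
Qed.

(** Apply [ac_increment_le] to the primitive of [k]; by Lebesgue's differentiation
    theorem its derivative is [k t] for almost every [t]. *)
Lemma ac_increment_integral (R : realType) (a b : R) (f k : R -> R) :
  a < b -> ac a b f -> (forall t, 0 <= k t) ->
  lebesgue_measure.-integrable `[a, b] (EFin \o k) ->
  {ae lebesgue_measure, forall t, t \in `]a, b[ -> forall e : R, 0 < e ->
     \forall h \near (0 : R), `|f (t + h) - f t| <= (k t + e) * `|h| } ->
  (`|f b - f a|%:E <= \int[lebesgue_measure]_(t in `[a, b]) (k t)%:E)%E.
Proof.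
move=> ab acf k0 ik hk.
pose kk := k \_ `[a, b].
have mab : measurable (`[a, b] : set R) by exact: measurable_itv.
have ikkT : lebesgue_measure.-integrable setT (EFin \o kk).
  by rewrite /kk -restrict_EFin; apply/(integrable_mkcond _ _).1.
have ikk (i : interval R) : lebesgue_measure.-integrable [set` i] (EFin \o kk).
  by apply: integrableS ikkT.
have lk : locally_integrable [set: R] kk by exact: integrable_locally.
pose F x := (\int[lebesgue_measure]_(t in `[a, x]) kk t)%R.
have kk0 t : 0 <= kk t by rewrite /kk patchE; case: ifP.
have FE x : (F x)%:E = (\int[lebesgue_measure]_(t in `[a, x]) (kk t)%:E)%E.
  rewrite /F /Rintegral fineK//.
  have := ikk `[a, x]; move/integrable_fin_num; apply.
  exact: measurable_itv.
have Fmon : {in `[a, b] &, {homo F : x y / x <= y}}.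
  move=> x y _ _ xy; rewrite -lee_fin !FE; apply: ge0_subset_integral => //.
  - by have /integrableP[] := ikk `[a, y].
  - by move=> t _; rewrite lee_fin.
  - by move=> t /=; rewrite !in_itv/= => /andP[-> /le_trans]; apply.
(* [k] is cut off outside [a, b] to have an integrable function on the line. *)
have hF := @FTC1 R kk (BLeft a) (fun y => ikk _) lk.
have [A [mA A0 hA]] := hF.
have [B [mB B0 hB]] := hk.
have N0 : lebesgue_measure (A `|` B) = 0%E.
  have : lebesgue_measure.-negligible (A `|` B).
    by apply: negligibleU; apply/negligibleP.
  by move/negligibleP; apply; exact: measurableU.
have := @ac_increment_le R a b f F (A `|` B) (ltW ab) acf Fmon (measurableU _ _ mA mB) N0.
move=> h.
rewrite (_ : (\int[lebesgue_measure]_(t in `[a, b]) (k t)%:E)%E = (F b - F a)%:E).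
  rewrite lee_fin; apply: h => t tab /not_orP[nA nB].
  have tab' : t \in `[a, b] by apply: subset_itv_oo_cc.
  exists (k t) => e e0; apply: filterI.
    have /contrapT := contra_not (hB t) nB.
    by move=> /(_ tab _ e0).
  have /contrapT := contra_not (hA t) nA.
  have at_ : (a%:E < t%:E)%E by rewrite lte_fin (itvP tab).
  move=> /(_ at_)[dF FE'].
  have dFt : is_derive t 1 F (k t).
    split=> //; rewrite -derive1E FE' /kk patchE mem_set//.
  have := is_derive1_near dFt e0; apply: filterS => x.
  by have -> : x *: k t = k t * x by rewrite mulrC.
rewrite EFinB !FE set_itv1 integral_set1 sube0.
by apply: eq_integral => t; rewrite inE /kk patchE => tab; rewrite mem_set.
Qed.

(** * Invariance and lower bounds of the distance *)

Section Curves.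
Variables (R : realType) (n s : nat) (G : carnotGroup R n s).
Local Notation V := 'rV[R]_n.
Local Notation "x ** y" := (cg_mul G x y) (at level 40, left associativity).
Local Notation X := (left_inv (cg_mul G)).
Local Notation wt := (cg_weight G).
Local Notation mu := lebesgue_measure.
Local Notation d := (cc_dist G).

Lemma sum_lt_of_le_scale (I : finType) (K : R) (F H : I -> R) (e : R) : 0 <= K -> 0 < e ->
  (forall i, F i <= K * H i) -> (forall i, 0 <= H i) ->
  \sum_i H i < e / (K + 1) -> \sum_i F i < e.
Proof.
move=> K0 e0 FH H0 h.
have K1 : 0 < K + 1 by rewrite ltr_wpDl.
apply: (@le_lt_trans _ _ (\sum_i (K + 1) * H i)).
  apply: ler_sum => i _; apply: le_trans (FH i) _.
  by rewrite ler_wpM2r// lerDl.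
by rewrite -mulr_sumr mulrC -ltr_pdivlMr.
Qed.

Lemma ac_comp (W : normedModType R) (a b K : R) (g : R -> V) (h : R -> W) :
  0 <= K -> abs_continuous a b g ->
  (forall x y, a <= x <= b -> a <= y <= b -> `|h x - h y| <= K * `|g x - g y|) ->
  ac a b h.
Proof.
move=> K0 acg hK e e0.
have [|r r0 hr] := acg (e / (K + 1)); first by rewrite divr_gt0// ltr_wpDl.
exists r => // k p q pq tr sr; apply: sum_lt_of_le_scale K0 e0 _ _ (hr k p q pq tr sr) => // i.
have [ap [pq' qb]] := pq i.
apply: hK; first by rewrite (le_trans ap).
by rewrite ap (le_trans pq').
Qed.

(** Creeping: steps shorter than [r] change [g] by at most [1]. *)
Lemma ac_bounded (a b : R) (g : R -> V) : a <= b -> abs_continuous a b g ->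
  exists2 M : R, 0 <= M & forall t, a <= t <= b -> `|g t| <= M.
Proof.
move=> ab acg; have [r r0 hr] := acg 1 ltr01.
have inc t t' : a <= t -> t <= t' -> t' <= b -> t' - t < r -> `|g t' - g t| <= 1.
  move=> at_ tt' t'b ttr; apply: ltW.
  have := hr 1%N (fun=> t) (fun=> t'); rewrite !big_ord1; apply => //.
  by move=> i j _ _ _; rewrite !ord1.
pose P t := exists2 M : R, 0 <= M & forall u, a <= u <= t -> `|g u| <= M.
suff : P b by [].
apply: (creeping_principle ab).
  exists `|g a| => // u /andP[au ua]; suff -> : u = a by [].
  by apply/eqP; rewrite eq_le ua.
move=> x _; exists (r / 2); first by rewrite divr_gt0.
move=> t t' at_ tx xt' t'b xr t'r [M M0 hM].
exists (M + 1); first by rewrite addr_ge0.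
move=> u /andP[au ut'].
have [ut|tu] := leP u t; first by apply: le_trans (hM u _) _; rewrite ?lerDl// au.
have h1 : `|g u - g t| <= 1.
  apply: inc => //; [exact: ltW|exact: le_trans t'b|].
  by move: xr t'r ut'; lra.
have h2 : `|g t| <= M by apply: hM; rewrite at_ lexx.
rewrite -(subrK (g t) (g u)) addrC (le_trans (ler_normD _ _))//.
exact: lerD.
Qed.

Definition speed (u : 'I_n -> R -> R) (t : R) :=
  Num.sqrt (\sum_(j | wt j == 1%N) u j t ^+ 2).

Lemma speed_ge0 u t : 0 <= speed u t. Proof. exact: sqrtr_ge0. Qed.

Lemma le_speed u t j : wt j = 1%N -> `|u j t| <= speed u t.
Proof.
move=> wj; rewrite -sqrtr_sqr ler_wsqrtr//.
rewrite (bigD1 j) ?wj//= lerDl sumr_ge0// => i _.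
exact: sqr_ge0.
Qed.

Lemma speed_le_sum u t : speed u t <= \sum_(j | wt j == 1%N) `|u j t|.
Proof.
have S0 : 0 <= \sum_(j | wt j == 1%N) `|u j t| by apply: sumr_ge0.
rewrite -[leRHS]ger0_norm// -sqrtr_sqr ler_wsqrtr//.
rewrite [leRHS]expr2 mulr_suml; apply: ler_sum => j wj.
rewrite -real_normK ?num_real// expr2 ler_wpM2l//.
by rewrite (bigD1 j)//= lerDl sumr_ge0.
Qed.

Lemma speed_measurable (D : set R) u : measurable D ->
  (forall j, wt j = 1%N -> measurable_fun D (u j)) -> measurable_fun D (speed u).
Proof.
move=> mD hu.
apply: (@measurableT_comp _ _ _ _ _ _ (@Num.sqrt R)).
  by apply: continuous_measurable_fun; exact: sqrt_continuous.
have -> : (fun t => \sum_(j | wt j == 1%N) u j t ^+ 2) =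
    (fun t => \sum_(j <- enum 'I_n) (if wt j == 1%N then u j t ^+ 2 else 0)).
  by apply/funext => t; rewrite big_mkcond/= big_enum.
apply: measurable_sum => j; case: eqP => wj; last exact: measurable_cst.
by apply: measurable_funX; exact: hu.
Qed.

Lemma speed_integrable (a b : R) u :
  (forall j, wt j = 1%N -> mu.-integrable `[a, b] (EFin \o u j)) ->
  mu.-integrable `[a, b] (EFin \o speed u).
Proof.
move=> hu.
have mab : measurable (`[a, b] : set R) by exact: measurable_itv.
pose S (t : R) : \bar R := (\sum_(j <- enum 'I_n | wt j == 1%N) `|(u j t)%:E|)%E.
suff iS : mu.-integrable `[a, b] S.
have := @le_integrable _ _ _ mu _ mab (EFin \o speed u) S.
apply.
- apply/measurable_EFinP; apply: speed_measurable => // j wj.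
  by apply/measurable_EFinP; have /integrableP[] := hu j wj.
- move=> t _; rewrite /= ger0_norm ?speed_ge0//.
  rewrite gee0_abs; last by apply: sume_ge0 => j _.
  rewrite /S (eq_bigr (fun j => `|u j t|%:E))// sumEFin lee_fin big_enum_cond/=; exact: speed_le_sum.
- exact: iS.
- apply: integrable_sum => // j /eqP wj.
  by apply: (integrable_abse); exact: hu.
Qed.

Lemma speed_integralZ (a b c : R) u :
  (forall j, wt j = 1%N -> mu.-integrable `[a, b] (EFin \o u j)) ->
  (\int[mu]_(t in `[a, b]) (c * speed u t)%:E =
   c%:E * \int[mu]_(t in `[a, b]) (speed u t)%:E)%E.
Proof.
move=> iu; have mab : measurable (`[a, b] : set R) by exact: measurable_itv.
rewrite -(@integralZl _ _ _ mu _ mab (EFin \o speed u) (speed_integrable iu)).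
by apply: eq_integral => t _; rewrite EFinM.
Qed.

Lemma curve_lengthE (a b : R) u :
  curve_length G a b u = (\int[mu]_(t in `[a, b]) (speed u t)%:E)%E.
Proof. by []. Qed.

Lemma X_bounded (r : R) : exists2 M : R, 0 <= M &
  forall x : V, `|x| <= r -> forall v, `|X v x| <= M * `|v|.
Proof.
have [K K0 hK] := dmul_bounded G r; exists K => // x xr v.
rewrite XE dmulE; have := hK x 0 xr _ 0 v; rewrite normr0 add0r; apply.
by rewrite (le_trans _ xr).
Qed.

Lemma delta_norm (j : 'I_n) : `|delta_mx 0 j : V| <= 1.
Proof.
by apply: norm_le_coord => // i; rewrite mxE/=; case: eqP => _; rewrite ?normr1 ?normr0.
Qed.

(** Along a horizontal curve [v] moves at most [K] times as fast as the curve, whose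
    Euclidean speed is at most a constant times [speed u] while it stays in the ball of
    radius [r]; outside this ball [v] does not move. *)
Lemma cc_dist_lipschitz (v : V -> R) (K r : R) :
  (forall x y, `|v x - v y| <= K * `|x - y|) -> (forall x, r < `|x| -> v x = 0) ->
  exists2 C : R, 0 < C & forall x y, (`|v x - v y|%:E <= C%:E * d x y)%E.
Proof.
move=> vK0 vr.
pose K' := Num.max K 0.
have K0 : 0 <= K' by rewrite le_max lexx orbT.
have vK x y : `|v x - v y| <= K' * `|x - y|.
  by apply: le_trans (vK0 x y) _; rewrite ler_wpM2r// le_max lexx.
have [M M0 hM] := X_bounded r.
pose C := K' * (n%:R * M).
have C0 : 0 <= C by rewrite !mulr_ge0.
exists (C + 1); first by rewrite ltr_wpDl.
move=> x y; rewrite -lee_pdivrMl; last by rewrite ltr_wpDl.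
apply: le_ereal_inf_tmp => _ [a [b [g [u [ab [acg iu dg] gx gy ->]]]]].
rewrite lee_pdivrMl; last by rewrite ltr_wpDl.
have isp := speed_integrable iu.
apply: (@le_trans _ _ (\int[mu]_(t in `[a, b]) (C * speed u t)%:E)%E); last first.
  rewrite curve_lengthE.
  rewrite (speed_integralZ _ iu).
  apply: lee_wpmul2r; last by rewrite lee_fin lerDl.
  by apply: integral_ge0 => t _; rewrite lee_fin speed_ge0.
rewrite -gx -gy distrC.
apply: (@ac_increment_integral R a b (fun t => v (g t)) (fun t => C * speed u t)) => //.
- by apply: (ac_comp K0 acg).
- by move=> t; rewrite mulr_ge0// speed_ge0.
- rewrite (_ : EFin \o _ = (fun t => (C%:E * (speed u t)%:E)%E)); last first.
    by apply/funext => t; rewrite /= EFinM.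
  by apply: integrableZl => //; exact: measurable_itv.
- move: dg; apply: (@filterS _ _ (ae_filter_ringOfSetsType mu)) => t ht tab e e0.
  have {}ht := ht tab.
  have e1 : 0 < e / (K' + 1) by rewrite divr_gt0// ltr_wpDl.
  have K1 : 0 < K' + 1 by rewrite ltr_wpDl.
  have near1 := is_derive1_near ht e1.
  have [gr|gr] := leP `|g t| r.
    move: near1; apply: filterS => h hh.
    apply: le_trans (vK _ _) _.
    set w := \sum_(j | _) _ in hh ht.
    have wb : `|w| <= n%:R * M * speed u t.
      rewrite /w; apply: le_trans (ler_norm_sum _ _ _) _.
      apply: (@le_trans _ _ (\sum_(j < n) M * speed u t)); last first.
        by rewrite sumr_const card_ord -[leLHS]mulr_natl mulrA.
      rewrite [leRHS](bigID (fun j => wt j == 1%N))/= -[leLHS]addr0.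
      apply: lerD; last by apply: sumr_ge0 => j _; rewrite mulr_ge0// speed_ge0.
      apply: ler_sum => j /eqP wj; rewrite normrZ mulrC.
      apply: ler_pM => //; last exact: le_speed.
      apply: le_trans (hM _ gr _) _; rewrite ler_piMr// delta_norm//.
    have h1 : `|g (t + h) - g t| <= (n%:R * M * speed u t + e / (K' + 1)) * `|h|.
      rewrite -(subrK (h *: w) (g (t + h) - g t)).
      apply: le_trans (ler_normD _ _) _; rewrite addrC mulrDl; apply: lerD => //.
      by rewrite normrZ mulrC ler_wpM2r.
    apply: le_trans (ler_wpM2l K0 h1) _.
    rewrite mulrA ler_wpM2r// mulrDr; apply: lerD; first by rewrite /C !mulrA.
    by rewrite mulrCA ler_piMr ?(ltW e0)// ler_pdivrMr// mul1r lerDl.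
  have cg : {for t, continuous g}.
    by apply: differentiable_continuous; apply/derivable1_diffP; case: ht.
  have v0 : v (g t) = 0 by exact: vr.
  have /nbhs_ballP[e2 /= e20 he2] : \forall y \near t, r < `|g y|.
    have cn : {for t, continuous (fun y => `|g y|)}.
      by apply: continuous_comp; [exact: cg|exact: norm_continuous].
    by have /cvgrPdist_lt := cn; move=> /(_ (`|g t| - r)); rewrite subr_gt0 => /(_ gr);
      apply: filterS => z; rewrite ltr_distlC => /andP[]; lra.
  apply/nbhs_ballP; exists e2 => // h; rewrite -ball_normE/= sub0r normrN => he.
  have E0 : 0 <= (C * speed u t + e) * `|h|.
    by rewrite mulr_ge0// addr_ge0 ?(ltW e0)// mulr_ge0// speed_ge0.
  rewrite v0 vr ?subrr ?normr0//.
  by apply: he2; rewrite -ball_normE/= opprD addNKr normrN.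
Qed.

(** A map that multiplies the horizontal basis fields by [c] turns a horizontal curve
    into one whose controls are multiplied by [c]. *)
Lemma cc_dist_transport (F : V -> V) (c : R) : 0 < c ->
  (forall x, differentiable F x) ->
  (forall r, exists2 K : R, 0 <= K & forall x y, `|x| <= r -> `|y| <= r ->
     `|F x - F y| <= K * `|x - y|) ->
  (forall x j, wt j = 1%N -> 'd F x (basis_field G j x) = c *: basis_field G j (F x)) ->
  forall x y, (d (F x) (F y) <= c%:E * d x y)%E.
Proof.
move=> c0 dF lF FX x y.
rewrite -lee_pdivrMl//; apply: le_ereal_inf_tmp => _ [a [b [g [u [ab [acg iu dg] gx gy ->]]]]].
rewrite lee_pdivrMl//; apply: ereal_inf_lbound.
exists a, b, (fun t => F (g t)), (fun j t => c * u j t).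
split; [exact: ab| | | |].
- split.
  + have [M M0 hM] := ac_bounded (ltW ab) acg.
    have [K K0 hK] := lF M.
    by apply: (ac_comp K0 acg) => t t' ht ht'; apply: hK; exact: hM.
  + move=> j wj; rewrite (_ : EFin \o _ = (fun t => (c%:E * (u j t)%:E)%E)); last first.
      by apply/funext => t; rewrite /= EFinM.
    by apply: integrableZl; [exact: measurable_itv|exact: iu].
  + move: dg; apply: (@filterS _ _ (ae_filter_ringOfSetsType mu)) => t ht tab.
    have := is_derive_diff_comp (dF (g t)) (ht tab).
    rewrite linear_sum/=; congr is_derive.
    apply: eq_bigr => j /eqP wj; rewrite linearZ/= FX// scalerA.
    by rewrite mulrC.
- by rewrite gx.
- by rewrite gy.
- rewrite !curve_lengthE -(speed_integralZ _ iu).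
  apply: eq_integral => t _; congr (_%:E).
  rewrite /speed; under [in RHS]eq_bigr do rewrite exprMn.
  by rewrite -mulr_sumr sqrtrM ?sqr_ge0// sqrtr_sqr ger0_norm// ltW.
Qed.

(** Left translations preserve left-invariant fields. *)
Lemma cc_dist_left (z x y : V) : (d (z ** x) (z ** y) <= d x y)%E.
Proof.
rewrite -[leRHS]mul1e.
apply: (@cc_dist_transport (cg_mul G z) 1) => //.
- exact: diff_mulr.
- move=> r; have [K K0 hK] := mul_lipschitz G (Num.max r `|z|).
  exists K => // x' y' xr yr.
  have := hK z z x' y'; rewrite subrr normr0 add0r; apply.
  + by rewrite le_max lexx orbT.
  + by rewrite le_max lexx orbT.
  + by rewrite le_max xr.
  + by rewrite le_max yr.
- move=> x' j wj; rewrite scale1r /basis_field.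
  have h := X_derive_comp G x' (scale0r _) (is_derive1_scale (delta_mx 0 j) (0 : R)).
  have := @is_derive_diff_comp _ _ _ (cg_mul G z) _ _ _ (diff_mulr _ _ _) h.
  rewrite scale0r (cg_mulx0 G) => h2.
  apply: (is_derive1_unique h2).
  under eq_fun do rewrite (cg_mulA G).
  exact: X_derive_comp (scale0r _) (is_derive1_scale _ _).
Qed.

(** Translation by [- z] gives the reverse inequality. *)
Lemma cc_dist_leftE (z x y : V) : d (z ** x) (z ** y) = d x y.
Proof.
apply/eqP; rewrite eq_le cc_dist_left/=.
by rewrite -[X in (X <= _)%E](_ : d (- z ** (z ** x)) (- z ** (z ** y)) = _) ?cc_dist_left// !mulKx.
Qed.

Lemma dil_lip r : exists2 K : R, 0 <= K & forall x y : V,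
  `|dilation G r x - dilation G r y| <= K * `|x - y|.
Proof.
pose S := \sum_j `|r ^+ wt j|.
have S0 : 0 <= S by apply: sumr_ge0.
exists S => // x y; rewrite -dilN -dilD.
apply: norm_le_coord; first by rewrite mulr_ge0.
move=> j; rewrite mxE normrM; apply: ler_pM => //; last exact: coord_le_norm.
by rewrite /S (bigD1 j)//= lerDl sumr_ge0.
Qed.

Lemma dil_diff r x : differentiable (dilation G r) x.
Proof.
have l : linear (dilation G r : V -> V) by move=> a u v; rewrite dilD dilZ.
pose lM := GRing.isLinear.Build _ _ _ _ _ l.
pose L : {linear V -> V} := HB.pack (dilation G r : V -> V) lM.
have -> : dilation G r = L by [].
apply: linear_differentiable => y.
have [K K0 hK] := dil_lip r.
apply/(@cvgrPdist_le R V V (nbhs y) (nbhs_filter y)) => e e0.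
apply/(@nbhs_ballP R V); exists (e / (K + 1)).
  by rewrite /= divr_gt0// ltr_wpDl.
move=> z; rewrite -ball_normE/= ltr_pdivlMr ?ltr_wpDl// => h.
apply: le_trans (hK y z) _; apply: le_trans (ltW h).
by rewrite mulrC ler_wpM2l// lerDl.
Qed.

(** The horizontal fields have weight [1], so [dil_X] gives the factor [r]. *)
Lemma cc_dist_dil (r : R) (x y : V) : 0 < r ->
  (d (dilation G r x) (dilation G r y) <= r%:E * d x y)%E.
Proof.
move=> r0; apply: (@cc_dist_transport (dilation G r) r) => //.
- exact: dil_diff.
- by move=> M; have [K K0 hK] := dil_lip r; exists K.
- move=> z j wj.
  have h := is_derive1_affine z (basis_field G j z) (0 : R).
  have := @is_derive_diff_comp _ _ _ (dilation G r) _ _ _ (dil_diff _ _) h.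
  rewrite scale0r addr0 => h2.
  have -> : 'd (dilation G r) z (basis_field G j z) = dilation G r (basis_field G j z).
    apply: (is_derive1_unique h2).
    exact: is_derive1_dil.
  rewrite /basis_field dil_X (dil_layer r (layer_basis G j)) wj expr1.
  by rewrite XZ.
Qed.

End Curves.

(** * Finiteness of the distance *)

Lemma lipschitz_glue (R : realType) (W : normedModType R) (f h : R -> W) (c k e M M' : R) :
  c <= k -> k <= e -> 0 <= M -> 0 <= M' -> f k = h k ->
  (forall x y, c <= x <= k -> c <= y <= k -> `|f x - f y| <= M * `|x - y|) ->
  (forall x y, k <= x <= e -> k <= y <= e -> `|h x - h y| <= M' * `|x - y|) ->
  let g t := if t <= k then f t else h t in
  forall x y, c <= x <= e -> c <= y <= e -> `|g x - g y| <= (M + M') * `|x - y|.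
Proof.
move=> ck ke M0 M'0 fh hf hh g.
have key x y : c <= x <= e -> c <= y <= e -> x <= y -> `|g x - g y| <= (M + M') * `|x - y|.
  move=> /andP[cx xe] /andP[cy ye] xy; rewrite /g.
  have [yk|ky] := leP y k.
    rewrite (le_trans xy yk); apply: le_trans (hf x y _ _) _; rewrite ?cx ?cy ?yk ?(le_trans xy)//.
    by rewrite ler_wpM2r// lerDl.
  have [xk|kx] := leP x k; last first.
    apply: le_trans (hh x y _ _) _; rewrite ?xe ?ye ?(ltW kx) ?(ltW ky)//.
    by rewrite ler_wpM2r// lerDr.
  have h1 : `|f x - f k| <= M * `|x - k| by apply: hf; rewrite ?cx ?xk ?ck ?lexx.
  have h2 : `|h k - h y| <= M' * `|k - y| by apply: hh; rewrite ?ke ?lexx ?ye ?(ltW ky).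
  have n1 : `|x - k| = k - x by rewrite distrC ger0_norm ?subr_ge0.
  have n2 : `|k - y| = y - k by rewrite distrC ger0_norm ?subr_ge0// ltW.
  have n3 : `|x - y| = y - x by rewrite distrC ger0_norm ?subr_ge0.
  rewrite -(subrKA (f k)) {2}fh; apply: le_trans (ler_normD _ _) _.
  apply: le_trans (lerD h1 h2) _; rewrite n1 n2 n3 mulrDl; apply: lerD.
    by rewrite ler_wpM2l// lerD2r ltW.
  by rewrite ler_wpM2l// lerD2l lerN2.
move=> x y hx hy; have [xy|/ltW yx] := leP x y; first exact: key.
by rewrite distrC (distrC x); exact: key.
Qed.

Section WordCurves.
Variables (R : realType) (n s : nat) (G : carnotGroup R n s).
Local Notation V := 'rV[R]_n.
Local Notation "x ** y" := (cg_mul G x y) (at level 40, left associativity).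
Local Notation X := (left_inv (cg_mul G)).
Local Notation wt := (cg_weight G).
Local Notation layer := (@layer_of R n wt).
Local Notation mu := lebesgue_measure.
Local Notation d := (cc_dist G).

Lemma X_flow (p v : V) (t c : R) :
  is_derive t 1 (fun u => p ** ((u - c) *: v)) (X v (p ** ((t - c) *: v))).
Proof.
apply: is_derive1_shift.
have -> : (fun u => p ** ((t + u - c) *: v)) =
    (fun u => (p ** ((t - c) *: v)) ** (u *: v)).
  by apply/funext => u; rewrite -(cg_mulA G) (cg_exp_coord G) addrAC.
exact: X_derive_comp (scale0r _) (is_derive1_scale _ _).
Qed.

Lemma X_horizontal v x : layer 1 v ->
  X v x = \sum_(j | wt j == 1%N) v 0 j *: basis_field G j x.
Proof.
move=> /layerP hv; rewrite {1}(row_sum_delta v).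
have -> : X (\sum_j v 0 j *: delta_mx 0 j) x = \sum_j v 0 j *: X (delta_mx 0 j) x.
  rewrite (big_morph (fun v => X v x) (XD G x) (X0 G x)).
  by apply: eq_bigr => j _; rewrite XZ.
rewrite (bigID (fun j => wt j == 1%N))/= [X in _ + X]big1 ?addr0//.
by move=> j wj; rewrite hv// scale0r.
Qed.

(** Follow the flow of one factor after the other, each during a unit of time. The
    controls are step functions, so the curve is Lipschitz and differentiable except at
    integer times. *)
Lemma word_curve (l : seq V) (B : R) :
  (forall v, v \in l -> layer 1 v /\ `|v| <= B) -> 0 <= B ->
  exists (g : R -> V) (u : 'I_n -> R -> R), [/\ g 0 = 0, g (size l)%:R = word G l,
   (exists2 M : R, 0 <= M & forall x y : R, 0 <= x <= (size l)%:R -> 0 <= y <= (size l)%:R ->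
      `|g x - g y| <= M * `|x - y|),
   (forall j, measurable_fun setT (u j)) /\ (forall j t, `|u j t| <= B) &
   (forall t : R, 0 < t < (size l)%:R -> (forall m : nat, t <> m%:R) ->
     is_derive t 1 g (\sum_(j | wt j == 1%N) u j t *: basis_field G j (g t)))].
Proof.
move=> hl B0; elim/last_ind: l hl => [|l v IH] hl.
  exists (fun=> 0), (fun _ _ => 0); split => //.
  - by exists 0 => // x y _ _; rewrite subrr normr0 mulr_ge0.
  - by split=> [j|j t]; [exact: measurable_cst|rewrite normr0].
  - by move=> t /andP[t0 t1]; move: (lt_trans t0 t1); rewrite ltxx.
have [|g [u [g0 gk [M M0 hM] [mu_ bu] dg]]] := IH.
  by move=> w wl; apply: hl; rewrite mem_rcons inE wl orbT.
have [hv vB] : layer 1 v /\ `|v| <= B by apply: hl; rewrite mem_rcons inE eqxx.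
rewrite size_rcons; set k := (size l)%:R in hM dg gk *.
set p := word G l in gk.
have k1 : (size l).+1%:R = k + 1 by rewrite /k -natr1.
pose h t := p ** ((t - k) *: v).
have k0 : 0 <= k by [].
have hk : h k = p by rewrite /h subrr scale0r (cg_mulx0 G).
have [K K0 hK] := mul_lipschitz G (Num.max `|p| `|v|).
exists (fun t => if t <= k then g t else h t), (fun j t => if t <= k then u j t else v 0 j).
split.
- by rewrite k0.
- rewrite k1 gerDl leNgt ltr01/= /h addrAC subrr add0r scale1r.
  by rewrite -cats1 word_cat /= (cg_mulx0 G).
- exists (M + K * `|v|); first by rewrite addr_ge0// mulr_ge0.
  rewrite k1; apply: lipschitz_glue => //.
  + by rewrite lerDl.
  + by rewrite mulr_ge0.
  + by rewrite hk.
  + move=> x y /andP[kx xk] /andP[ky yk].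
    have b t : k <= t -> t <= k + 1 -> `|(t - k) *: v| <= Num.max `|p| `|v|.
      move=> kt tk; rewrite le_max normrZ ler_piMl ?orbT//.
      by rewrite ger0_norm ?subr_ge0// lerBlDl.
    have := hK p p ((x - k) *: v) ((y - k) *: v).
    rewrite subrr normr0 add0r le_max lexx => /(_ isT isT (b _ kx xk) (b _ ky yk)).
    by rewrite -scalerBl opprB addrA subrK normrZ [`|x - y| * _]mulrC mulrA.
- split=> [j|j t].
  + apply: measurable_fun_ifT; [|exact: mu_|exact: measurable_cst].
    apply: (@measurable_fun_ler _ _ _ _ (fun t : R => t) (fun=> k)).
      exact: measurable_id.
    exact: measurable_cst.
  + case: ifP => _ //; exact: le_trans (coord_le_norm v j) vB.
- rewrite k1 => t /andP[t0 t1] tm.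
  have [tk|kt] := leP t k.
    have {}tk : t < k by rewrite lt_neqAle tk andbT; apply/eqP; exact: tm.
    apply: (@near_eq_is_derive _ _ _ g); last by apply: dg; rewrite ?t0.
    near=> x; rewrite ifT//; apply: ltW; near: x; exact: lt_nbhsl.
  apply: (@near_eq_is_derive _ _ _ h).
    near=> x; rewrite ifF//; apply/negbTE; rewrite -ltNge; near: x; exact: lt_nbhsr.
  rewrite -X_horizontal//; exact: X_flow.
Unshelve. all: by end_near. Qed.

(** The bound is the length of the curve of [word_curve]. *)
Lemma cc_dist_word (N : nat) (B : R) : exists M : R, forall x : V,
  hreach G N B x -> (d 0 x <= M%:E)%E.
Proof.
pose B' := Num.max B 0.
have B0 : 0 <= B' by rewrite le_max lexx orbT.
pose c := Num.sqrt (\sum_(j < n | wt j == 1%N) B' ^+ 2).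
have c0 : 0 <= c by exact: sqrtr_ge0.
exists (c * (N.+1)%:R) => x [l [sl hl lx]].
(* The extra factor [0] makes the time interval nontrivial when [l] is
   empty. *)
have hl' : forall v, v \in rcons l 0 -> layer 1 v /\ `|v| <= B'.
  move=> v; rewrite mem_rcons inE => /orP[/eqP ->|/hl[h1 h2]].
    by rewrite normr0; split => //; exact: layer0.
  by split=> //; rewrite le_max h2.
have [g [u [g0 gk [M M0 hM] [mu_ bu] dg]]] := word_curve hl' B0.
move: hM gk dg; rewrite size_rcons => hM gk dg.
set T : R := (size l).+1%:R in hM gk dg.
have T0 : 0 < T by rewrite ltr0n.
have mT : measurable (`[0, T] : set R) by exact: measurable_itv.
have hT : mu (`[0, T] : set R) = T%:E.
  by rewrite lebesgue_measure_itv/= lte_fin T0 sube0.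
have iu j : mu.-integrable `[0, T] (EFin \o u j).
  apply: measurable_bounded_integrable => //.
  - by move: (ltry T); rewrite -hT.
  - exact: measurable_funS (mu_ j).
  - exists B'; split; first exact: num_real.
    by move=> z Bz t _; exact: le_trans (bu j t) (ltW Bz).
apply: (@le_trans _ _ (curve_length G 0 T u)).
  apply: ereal_inf_lbound; exists 0, T, g, u; split => //.
  - split=> //.
    + move=> e e0; have M1 : 0 < M + 1 by rewrite ltr_wpDl.
      exists (e / (M + 1)); first by rewrite divr_gt0.
      move=> k p q pq _ h; apply: (sum_lt_of_le_scale M0 e0 _ _ h).
        move=> i; have [h1 [h2 h3]] := pq i.
        rewrite -[q i - p i]ger0_norm ?subr_ge0//; apply: hM.
          by rewrite h3 (le_trans h1).
        by rewrite h1 (le_trans h2).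
      by move=> i; have [_ [h2 _]] := pq i; rewrite subr_ge0.
    + have cN : countable (range (fun m : nat => m%:R : R)) by exact: card_image_le.
      exists (range (fun m : nat => m%:R : R)); split.
      * exact: countable_measurable.
      * exact: countable_lebesgue_measure0.
      * move=> t /= ht; apply: contrapT => tN; apply: ht => tT.
        apply: dg; first by move: tT; rewrite in_itv.
        by move=> m tm; apply: tN; exists m.
  - rewrite gk -cats1 word_cat/= (cg_mulx0 G) (cg_mulx0 G)//.
rewrite curve_lengthE.
have hs t : speed G u t <= c.
  apply: ler_wsqrtr; apply: ler_sum => j _.
  by rewrite -real_normK ?num_real// lerXn2r ?nnegrE.
have h1 : (\int[mu]_(t in `[0%R, T]) (speed G u t)%:E <= \int[mu]_(t in `[0%R, T]) c%:E)%E.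
  apply: ge0_le_integral => //.
  - by move=> t _; rewrite lee_fin speed_ge0.
  - by have /integrableP[] := @speed_integrable R n s G 0 T u (fun j _ => iu j).
  - by move=> t _; rewrite lee_fin hs.
apply: le_trans h1 _.
rewrite integral_cst//.
have -> : (c%:E * mu (`[0%R, T]%classic : set R) = (c * T)%:E)%E by rewrite hT.
by rewrite lee_fin ler_wpM2l// ler_nat ltnS.
Qed.

Lemma cc_dist_bounded_nbhs : exists (M r : R), 0 < r /\
  forall x : V, `|x| <= r -> (d 0 x <= M%:E)%E.
Proof.
have [N [B [r [r0 hr]]]] := hreach_nbhs G.
have [M hM] := cc_dist_word N B.
by exists M, r; split=> // x xr; apply: hM; exact: hr.
Qed.

End WordCurves.

(** * The homogeneous norm *)

Section CarnotNorm.
Variables (R : realType) (n s : nat) (G : carnotGroup R n s).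
Local Notation V := 'rV[R]_n.
Local Notation "x ** y" := (cg_mul G x y) (at level 40, left associativity).
Local Notation dil := (dilation G).
Local Notation d := (cc_dist G).

Lemma dilM (a b : R) (x : V) : dil a (dil b x) = dil (a * b) x.
Proof. by apply/rowP => j; rewrite !mxE mulrA exprMn. Qed.

Lemma dil1 (x : V) : dil 1 x = x.
Proof. by apply/rowP => j; rewrite !mxE expr1n mul1r. Qed.

Lemma dil_norm_le (t : R) (x : V) : 0 <= t <= 1 -> `|dil t x| <= t * `|x|.
Proof.
move=> /andP[t0 t1]; apply: norm_le_coord; first by rewrite mulr_ge0.
move=> j; rewrite mxE normrM ger0_norm ?exprn_ge0//.
apply: ler_pM => //; rewrite ?exprn_ge0 ?coord_le_norm//.
by have /andP[w0 _] := cg_weight_bounds G j; rewrite -(prednK w0) exprS ler_piMr// exprn_ile1.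
Qed.

Lemma dilV_norm_le (t : R) (x : V) : 0 < t <= 1 -> `|dil t^-1 x| <= t ^- s * `|x|.
Proof.
move=> /andP[t0 t1]; have ti : 1 <= t^-1 by rewrite invr_ge1 ?unitfE ?gt_eqF.
have t0' := ltW t0.
apply: norm_le_coord; first by rewrite mulr_ge0// invr_ge0 exprn_ge0.
move=> j; rewrite mxE normrM ger0_norm; last by rewrite exprn_ge0// invr_ge0.
rewrite -exprVn; apply: ler_pM => //; rewrite ?exprn_ge0 ?invr_ge0 ?coord_le_norm//.
by have /andP[_ ws] := cg_weight_bounds G j; rewrite ler_weXn2l.
Qed.

Lemma cc_dist_ge0 (x y : V) : (0 <= d x y)%E.
Proof.
apply: le_ereal_inf_tmp => _ [a [b [g [u [ab [acg iu dg] gx gy ->]]]]].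
by apply: integral_ge0 => t _; rewrite lee_fin sqrtr_ge0.
Qed.

(** A dilation brings [x] into the neighbourhood where Chow's theorem bounds the
    distance. *)
Lemma cc_dist_fin0 (x : V) : d 0 x \is a fin_num.
Proof.
have [M [r [r0 hr]]] := cc_dist_bounded_nbhs G.
pose t := Num.min 1 (r / (`|x| + 1)).
have x1 : 0 < `|x| + 1 by rewrite ltr_wpDl.
have t0 : 0 < t by rewrite lt_min ltr01/= divr_gt0.
have xr : `|dil t x| <= r.
  apply: (@le_trans _ _ (t * `|x|)); first by apply: dil_norm_le; rewrite (ltW t0) ge_min lexx.
  apply: (@le_trans _ _ (r / (`|x| + 1) * (`|x| + 1))); last by rewrite divfK ?gt_eqF.
  by apply: ler_pM => //; rewrite ?(ltW t0)// ?lerDl// ge_min lexx orbT.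
have := cc_dist_dil G 0 (dil t x) (r := t^-1); rewrite dil0 dilM mulVf ?gt_eqF// dil1 invr_gt0.
move=> /(_ t0) h; rewrite ge0_fin_numE ?cc_dist_ge0//.
apply: le_lt_trans h _; apply: (@le_lt_trans _ _ (t^-1%:E * M%:E)%E); last by rewrite -EFinM ltry.
by apply: lee_wpmul2l; [rewrite lee_fin invr_ge0 ltW|exact: hr].
Qed.

Definition cc_norm (h : V) : R := fine (d h 0).

Lemma cc_distE (x y : V) : d x y = (cc_norm (- y ** x))%:E.
Proof.
rewrite /cc_norm -(mulNx G y) cc_dist_leftE fineK//.
by rewrite -(cc_dist_leftE G (- x)) mulNx cc_dist_fin0.
Qed.

Lemma cc_norm_ge0 h : 0 <= cc_norm h.
Proof. by apply: fine_ge0; exact: cc_dist_ge0. Qed.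

Lemma cc_dist_0r h : d h 0 = (cc_norm h)%:E.
Proof. by rewrite cc_distE oppr0 (cg_mul0x G). Qed.

Lemma cc_dist_0l h : d 0 h = (cc_norm (- h))%:E.
Proof. by rewrite cc_distE (cg_mulx0 G). Qed.

Lemma cc_norm_left z x y : cc_norm (- (z ** y) ** (z ** x)) = cc_norm (- y ** x).
Proof. by have := cc_dist_leftE G z x y; rewrite !cc_distE => -[]. Qed.

Lemma cc_norm_dil_mul t x y : 0 < t ->
  cc_norm (- dil t y ** dil t x) = t * cc_norm (- y ** x).
Proof.
move=> t0; have le r a b : 0 < r -> cc_norm (- dil r b ** dil r a) <= r * cc_norm (- b ** a).
  by move=> r0; have := cc_dist_dil G a b r0; rewrite !cc_distE -EFinM lee_fin.
apply/eqP; rewrite eq_le le//= -ler_pdivlMl//.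
have ti : 0 < t^-1 by rewrite invr_gt0.
by have := le _ (dil t x) (dil t y) ti; rewrite !dilM mulVf ?gt_eqF// !dil1.
Qed.

Lemma cc_norm_dil t h : 0 < t -> cc_norm (dil t h) = t * cc_norm h.
Proof. by move=> /(cc_norm_dil_mul h 0); rewrite dil0 oppr0 !(cg_mul0x G). Qed.

Lemma cc_norm_bounded : exists M r : R, [/\ 0 <= M, 0 < r & forall x, `|x| <= r -> cc_norm x <= M].
Proof.
have [M [r [r0 hr]]] := cc_dist_bounded_nbhs G.
exists M, r; split=> //.
  have := hr 0; rewrite normr0 => /(_ (ltW r0)); rewrite cc_dist_0l lee_fin.
  exact: le_trans (cc_norm_ge0 _).
by move=> x xr; have := hr (- x); rewrite normrN => /(_ xr); rewrite cc_dist_0l opprK lee_fin.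
Qed.

(** Dilation by [1 / (M + 1)] turns the bound [M] into a bound less than [1], on a smaller
    Euclidean ball. *)
Lemma cc_norm_small : exists2 r : R, 0 < r & forall x, `|x| <= r -> cc_norm x < 1.
Proof.
have [M [r [M0 r0 hr]]] := cc_norm_bounded.
pose t := (M + 1)^-1.
have M1 : 0 < M + 1 by rewrite ltr_wpDl.
have t0 : 0 < t by rewrite invr_gt0.
have t1 : t <= 1 by rewrite invf_le1// lerDr.
exists (t ^+ s * r); first by rewrite mulr_gt0// exprn_gt0.
move=> x xr; have -> : x = dil t (dil t^-1 x) by rewrite dilM mulfV ?gt_eqF// dil1.
rewrite cc_norm_dil// mulrC ltr_pdivrMr// mul1r.
apply: le_lt_trans (hr _ _) _; last by rewrite ltrDl.
apply: le_trans (dilV_norm_le _ _) _; first by rewrite t0.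
by rewrite mulrC ler_pdivrMr ?exprn_gt0// mulrC.
Qed.

(** [cc_dist_lipschitz] for a Euclidean cone of height and radius [1] centred at [0]. *)
Lemma norm_le_cc_norm : exists2 C : R, 0 < C &
  forall h, C * cc_norm h < 1 -> `|h| <= C * cc_norm h.
Proof.
pose v (x : V) := Num.max 0 (1 - `|x|).
have [||C C0 hC] := @cc_dist_lipschitz R n s G v 1 1.
- move=> x y; rewrite mul1r /v.
  have := ler_dist_dist x y; rewrite ler_norml => /andP[h1 h2].
  by rewrite ler_norml; apply/andP; split; case: (leP 0 (1 - `|x|)); case: (leP 0 (1 - `|y|)); lra.
- by move=> x x1; apply/max_idPl; lra.
exists C => // h Ch; have := hC h 0; rewrite cc_dist_0r -EFinM lee_fin.
rewrite /v normr0 subr0 (max_idPr ler01) distrC => /(le_trans (ler_norm _)).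
by case: (leP 0 (1 - `|h|)); lra.
Qed.

Lemma cc_norm_gt0 h : h != 0 -> 0 < cc_norm h.
Proof.
move=> h0; have [C C0 hC] := norm_le_cc_norm.
rewrite ltNge; apply/negP => N0; have {}N0 : cc_norm h = 0.
  by apply/eqP; rewrite eq_le N0 cc_norm_ge0.
have := hC h; rewrite N0 mulr0 => /(_ ltr01); rewrite normr_le0; exact/negP.
Qed.

(** Dilate [h] to a fixed size: there [cc_norm] is bounded below and, at [- h], above. *)
Lemma cc_norm_opp : exists2 C : R, 0 < C & forall h, cc_norm (- h) <= C * cc_norm h.
Proof.
have [M [r [M0 r0 hr]]] := cc_norm_bounded.
have [C C0 hC] := norm_le_cc_norm.
pose q := Num.min r 2^-1.
have q0 : 0 < q by rewrite lt_min r0 invr_gt0 ltr0n.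
have qr : q <= r by rewrite ge_min lexx.
have q1 : q < 1 by rewrite gt_min invf_lt1 ?ltr0n// ltr1n orbT.
exists (Num.max 1 (M * C / q)); first by rewrite lt_max ltr01.
move=> h; have [->|h0] := eqVneq h 0.
  by rewrite oppr0 ler_peMl ?cc_norm_ge0// le_max lexx.
have N0 := cc_norm_gt0 h0.
pose t := q / (C * cc_norm h).
have t0 : 0 < t by rewrite divr_gt0// mulr_gt0.
have tr : `|dil t h| <= r.
  have := hC (dil t h); rewrite cc_norm_dil//.
  have -> : C * (t * cc_norm h) = q by rewrite /t; field; rewrite !gt_eqF.
  by move=> /(_ q1) /le_trans; apply.
have := hr (- dil t h); rewrite normrN -dilN => /(_ tr); rewrite cc_norm_dil//.
rewrite -ler_pdivlMl// => /le_trans; apply.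
rewrite maxr_pMl ?cc_norm_ge0// le_max; apply/orP; right.
by rewrite le_eqVlt; apply/orP; left; apply/eqP; rewrite /t; field; rewrite !gt_eqF.
Qed.

End CarnotNorm.

(** * Infima of bumps over the holes of a set *)

Section Bumps.
Variables (R : realType) (n s : nat) (G : carnotGroup R n s).
Local Notation V := 'rV[R]_n.
Local Notation "x ** y" := (cg_mul G x y) (at level 40, left associativity).
Local Notation wt := (cg_weight G).
Local Notation dil := (dilation G).
Local Notation d := (cc_dist G).
Local Notation N := (cc_norm G).

Definition quad (r : R) (x : V) : R := \sum_j x 0 j ^+ 2 - r ^+ 2.
(** A paraboloid cut off at height [0]. It is not smooth on the boundary of its
    support, but it lies below the smooth function [quad], and equals it wherever it
    is negative. *)
Definition cap (r : R) (x : V) : R := Num.min 0 (quad r x).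
Definition bump (r : R) (z : V) (rho : R) (y : V) : R :=
  rho * cap r (dil rho^-1 (- z ** y)).

Lemma cap_le0 r x : cap r x <= 0.
Proof. by rewrite ge_min lexx. Qed.

Lemma cap_ge r x : - r ^+ 2 <= cap r x.
Proof.
rewrite le_min oppr_le0 sqr_ge0 /quad lerDr/=.
by apply: sumr_ge0 => j _; exact: sqr_ge0.
Qed.

Lemma cap_lt0 r x : 0 <= r -> cap r x < 0 -> `|x| <= r.
Proof.
move=> r0; rewrite gt_min ltxx/= subr_lt0 => h.
apply: norm_le_coord => // j; rewrite -(ler_pXn2r (n := 2))// ?nnegrE// real_normK ?num_real//.
apply: le_trans (ltW h); rewrite (bigD1 j)//= lerDl.
by apply: sumr_ge0 => k _; exact: sqr_ge0.
Qed.

Lemma cap0 r : cap r 0 = - r ^+ 2.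
Proof.
rewrite /cap /quad big1 => [|j _]; last by rewrite mxE expr0n.
by rewrite add0r; apply/min_idPr; rewrite oppr_le0 sqr_ge0.
Qed.

(** If [cap r x < cap r y] then [|x| <= r]; nearby [y] are then compared through the
    polynomial [quad], and for the others the oscillation [r ^+ 2] of [cap] is enough. *)
Lemma cap_euclid_lipschitz r : 0 <= r -> exists K : R, forall x y : V,
  `|cap r x - cap r y| <= K * `|x - y|.
Proof.
move=> r0; pose K := n%:R * (2 * r + 1) + r ^+ 2.
have K0 : 0 <= n%:R * (2 * r + 1) by rewrite mulr_ge0// addr_ge0// mulr_ge0.
have key x y : cap r x <= cap r y -> cap r y - cap r x <= K * `|y - x|.
  rewrite le_eqVlt => /orP[/eqP ->|xy].
    by rewrite subrr mulr_ge0// addr_ge0// sqr_ge0.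
  have xr : `|x| <= r by apply: cap_lt0 => //; apply: lt_le_trans xy (cap_le0 _ _).
  have [yx|yx] := leP `|y - x| 1; last first.
    apply: (@le_trans _ _ (r ^+ 2)).
      by have := cap_ge r x; have := cap_le0 r y; lra.
    apply: (@le_trans _ _ (K * 1)); first by rewrite mulr1 lerDr.
    by apply: ler_wpM2l; [rewrite addr_ge0// sqr_ge0|exact: ltW].
  have cx : cap r x = quad r x.
    by apply/min_idPr; have := lt_le_trans xy (cap_le0 _ _); rewrite gt_min ltxx/= => /ltW.
  have cy : cap r y <= quad r y by rewrite ge_min lexx orbT.
  apply: (@le_trans _ _ (quad r y - quad r x)); first by rewrite cx lerD2r.
  rewrite /quad opprB addrA subrK -sumrB.
  apply: (@le_trans _ _ (\sum_(j < n) (2 * r + 1) * `|y - x|)).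
    apply: ler_sum => j _; rewrite subr_sqr mulrC.
    apply: le_trans (ler_norm _) _; rewrite normrM; apply: ler_pM => //.
      have -> : y 0 j + x 0 j = (y - x) 0 j + 2 * x 0 j by rewrite !mxE; ring.
      apply: le_trans (ler_normD _ _) _; rewrite addrC; apply: lerD;
        last exact: le_trans (coord_le_norm _ _) yx.
      by rewrite normrM ger0_norm// ler_wpM2l//; exact: le_trans (coord_le_norm _ _) xr.
    by have := coord_le_norm (y - x) j; rewrite !mxE.
  rewrite sumr_const card_ord -[leLHS]mulr_natl mulrA ler_wpM2r//.
  by rewrite lerDl sqr_ge0.
exists K => x y; have [xy|/ltW yx] := leP (cap r x) (cap r y).
  by rewrite distrC (distrC x) ger0_norm ?subr_ge0//; exact: key.
by rewrite ger0_norm ?subr_ge0//; exact: key.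
Qed.

Lemma cap_lipschitz r : 0 <= r -> exists2 C : R, 0 < C &
  forall x y, `|cap r x - cap r y| <= C * N (- y ** x).
Proof.
move=> r0; have [K hK] := cap_euclid_lipschitz r0.
have [||C C0 hC] := @cc_dist_lipschitz R n s G (cap r) K r => //.
  move=> x rx; apply/eqP; rewrite eq_le cap_le0/= leNgt; apply/negP => /(cap_lt0 r0).
  by rewrite leNgt rx.
by exists C => // x y; have := hC x y; rewrite cc_distE -EFinM lee_fin.
Qed.

(** The scaling factors [rho] and [rho^-1] cancel: the Lipschitz constant depends neither
    on the centre nor on the scale. *)
Lemma bump_lipschitz r : 0 <= r -> exists2 C : R, 0 < C & forall z rho x y, 0 < rho ->
  `|bump r z rho x - bump r z rho y| <= C * N (- y ** x).
Proof.
move=> r0; have [C C0 hC] := cap_lipschitz r0; exists C => // z rho x y rho0.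
rewrite /bump -mulrBr normrM gtr0_norm// -ler_pdivlMl//.
apply: le_trans (hC _ _) _; rewrite cc_norm_dil_mul ?invr_gt0// cc_norm_left.
by rewrite mulrCA.
Qed.

Lemma bump_support r z rho y : 0 <= r -> (forall x, `|x| <= r -> N x < 1) -> 0 < rho ->
  bump r z rho y < 0 -> N (- y ** z) < rho.
Proof.
move=> r0 hr rho0; rewrite pmulr_rlt0// => /(cap_lt0 r0); rewrite -normrN => /hr.
rewrite -dilN cc_norm_dil ?invr_gt0// oppM opprK.
by rewrite -ltr_pdivlMl ?invr_gt0// invrK mulr1.
Qed.

Lemma bump_center r z rho : bump r z rho z = - (r ^+ 2 * rho).
Proof. by rewrite /bump mulNx dil0 cap0 mulrN mulrC. Qed.

(** Writing [A], [B] for [b ** h] and [b ** - h], coordinatewise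
    [A^2 + B^2 - 2 b^2 = (A - b)^2 + (B - b)^2 + 2 b (A + B - 2 b)]:
    the squares are quadratic in [h], and [mul_sym_diff] bounds the last term. The
    dilation only costs the factors [t ^- wt j], so the bound is uniform for scales [t]
    bounded away from [0]. *)
Lemma quad_sym_diff (r M e : R) : 0 < r -> 0 <= M -> 0 < e -> exists2 eta : R, 0 < eta &
  forall (b h : V) t, 0 < t -> `|b| <= r -> (forall j, t ^- wt j <= M) -> `|h| <= eta ->
    quad r (dil t^-1 (b ** h)) + quad r (dil t^-1 (b ** (- h))) - 2 * quad r (dil t^-1 b)
      <= e * `|h|.
Proof.
move=> r0 M0 e0.
have [K K0 hK] := mul_lipschitz G (Num.max r 1).
(* [e1] and [e2] give [e / 2] each to the linear and to the quadratic term. *)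
pose Q := n%:R * M ^+ 2 + 1.
have Q0 : 0 < Q by rewrite ltr_wpDl// mulr_ge0// sqr_ge0.
pose e1 := e / (4 * r * Q).
have e10 : 0 < e1 by rewrite divr_gt0// !mulr_gt0.
have [dd dd0 hdd] := mul_sym_diff G r e10.
pose e2 := e / (4 * Q * (K ^+ 2 + 1)).
have K1 : 0 < K ^+ 2 + 1 by rewrite ltr_wpDl// sqr_ge0.
have e20 : 0 < e2 by rewrite divr_gt0// !mulr_gt0.
exists (Num.min 1 (Num.min dd e2)); first by rewrite !lt_min ltr01 dd0 e20.
move=> b h t t0 br tM; rewrite !le_min => /and3P[h1 hd he2].
have kA (k : V) : `|k| <= 1 -> `|b ** k - b| <= K * `|k|.
  move=> k1; have := hK b b k 0; rewrite (cg_mulx0 G) subrr normr0 subr0 add0r; apply.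
  - by rewrite le_max br.
  - by rewrite le_max br.
  - by rewrite le_max k1 orbT.
  - by rewrite le_max ler01 orbT.
have hA := kA h h1.
have hB : `|b ** - h - b| <= K * `|h| by rewrite -[in leRHS]normrN; apply: kA; rewrite normrN.
have hS := hdd b h br hd.
set A := b ** h in hA hS *; set B := b ** - h in hB hS *.
have r1 : 0 < 4 * r by rewrite mulr_gt0.
have coord j : (A 0 j) ^+ 2 + (B 0 j) ^+ 2 - 2 * (b 0 j) ^+ 2 <=
   2 * K ^+ 2 * `|h| ^+ 2 + 2 * r * e1 * `|h|.
  have a1 : `|A 0 j - b 0 j| <= K * `|h|.
    by apply: le_trans hA; have := coord_le_norm (A - b) j; rewrite !mxE.
  have a2 : `|B 0 j - b 0 j| <= K * `|h|.
    by apply: le_trans hB; have := coord_le_norm (B - b) j; rewrite !mxE.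
  have a3 : `|A 0 j + B 0 j - 2 * b 0 j| <= e1 * `|h|.
    by apply: le_trans hS; have := coord_le_norm (A + B - 2 *: b) j; rewrite !mxE.
  have a4 : `|b 0 j| <= r by exact: le_trans (coord_le_norm _ _) br.
  have sq (x : R) : `|x| <= K * `|h| -> x ^+ 2 <= K ^+ 2 * `|h| ^+ 2.
    move=> xb; rewrite -exprMn -real_normK ?num_real// lerXn2r ?nnegrE//.
    by rewrite mulr_ge0.
  have s1 := sq _ a1; have s2 := sq _ a2.
  have s3 : b 0 j * (A 0 j + B 0 j - 2 * b 0 j) <= r * (e1 * `|h|).
    by apply: le_trans (ler_norm _) _; rewrite normrM ler_pM.
  have -> : A 0 j ^+ 2 + B 0 j ^+ 2 - 2 * b 0 j ^+ 2 =
    (A 0 j - b 0 j) ^+ 2 + (B 0 j - b 0 j) ^+ 2 + 2 * (b 0 j * (A 0 j + B 0 j - 2 * b 0 j)) by ring.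
  have -> : 2 * K ^+ 2 * `|h| ^+ 2 + 2 * r * e1 * `|h| =
    K ^+ 2 * `|h| ^+ 2 + K ^+ 2 * `|h| ^+ 2 + 2 * (r * (e1 * `|h|)) by ring.
  by apply: lerD; [exact: lerD|rewrite ler_wpM2l].
set c := 2 * K ^+ 2 * `|h| ^+ 2 + 2 * r * e1 * `|h| in coord.
have c0 : 0 <= c.
  have r0' := ltW r0; have e10' := ltW e10.
  by apply: addr_ge0; repeat (apply: mulr_ge0 => //); exact: sqr_ge0.
have -> : quad r (dil t^-1 A) + quad r (dil t^-1 B) - 2 * quad r (dil t^-1 b) =
   \sum_j (t ^- wt j) ^+ 2 * (A 0 j ^+ 2 + B 0 j ^+ 2 - 2 * b 0 j ^+ 2).
  rewrite /quad; under [RHS]eq_bigr do rewrite mulrBr mulrDr.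
  rewrite sumrB big_split/=; under [X in _ = _ - X]eq_bigr do rewrite mulrCA.
  rewrite -mulr_sumr.
  have sqE x : \sum_j dil t^-1 x 0 j ^+ 2 = \sum_j (t ^- wt j) ^+ 2 * x 0 j ^+ 2.
    by apply: eq_bigr => j _; rewrite mxE exprMn -[in RHS]exprVn.
  by rewrite !sqE; ring.
apply: (@le_trans _ _ (\sum_(j < n) M ^+ 2 * c)).
  apply: ler_sum => j _; have m0 : 0 <= t ^- wt j by rewrite invr_ge0 exprn_ge0// ltW.
  apply: (@le_trans _ _ ((t ^- wt j) ^+ 2 * c)); first by rewrite ler_wpM2l ?sqr_ge0.
  by rewrite ler_wpM2r// lerXn2r ?nnegrE.
rewrite sumr_const card_ord -[leLHS]mulr_natl mulrA.
apply: (@le_trans _ _ (Q * c)); first by rewrite ler_wpM2r// lerDl.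
have -> : e * `|h| = Q * ((2 * (K ^+ 2 + 1) * e2 + 2 * r * e1) * `|h|).
  by rewrite /e2 /e1; field; rewrite !gt_eqF.
rewrite ler_pM2l// mulrDl lerD2r [`|h| ^+ 2]expr2 [leLHS]mulrA ler_wpM2r//.
by apply: ler_pM => //; rewrite ?mulr_ge0 ?sqr_ge0// ler_wpM2l// lerDl.
Qed.

(** [N (- y ** z)] is the distance from [z] to [y]. *)
Definition hole (E : set V) (z : V) (rho : R) :=
  forall y, N (- y ** z) < rho -> ~ E y.

(** The value [0] makes the set nonempty when [E] has no holes; the bound [rho <= 1]
    makes it bounded below. *)
Definition gap (r : R) (E : set V) (y : V) : R :=
  inf [set v | v = 0 \/ exists z rho, [/\ 0 < rho <= 1, hole E z rho & v = bump r z rho y]].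

Section Gap.
Variables (r : R) (E : set V).
Hypotheses (r0 : 0 < r) (hr : forall x, `|x| <= r -> N x < 1).
Let S y := [set v | v = 0 \/ exists z rho, [/\ 0 < rho <= 1, hole E z rho & v = bump r z rho y]].

Lemma gap_lb y v : S y v -> - r ^+ 2 <= v.
Proof.
case=> [->|[z [rho [/andP[h1 h2] _ ->]]]]; first by rewrite oppr_le0 sqr_ge0.
rewrite /bump; set c := cap _ _.
have c1 : - r ^+ 2 <= c by exact: cap_ge.
have c2 : c <= 0 by exact: cap_le0.
apply: le_trans c1 _; rewrite -[leLHS]mul1r -subr_ge0 -mulrBl.
by rewrite mulr_le0// subr_le0.
Qed.

Lemma gap_has_inf y : has_inf (S y).
Proof.
by split; [exists 0; left|exists (- r ^+ 2); move=> v; exact: gap_lb].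
Qed.

Lemma gap_le y v : S y v -> gap r E y <= v.
Proof. by apply: ge_inf; case: (gap_has_inf y). Qed.

Lemma gap_le0 y : gap r E y <= 0.
Proof. by apply: gap_le; left. Qed.

Lemma gap_ge y : - r ^+ 2 <= gap r E y.
Proof.
by apply: lb_le_inf; [case: (gap_has_inf y)|move=> v; exact: gap_lb].
Qed.

Lemma gap_eq0 y : E y -> gap r E y = 0.
Proof.
move=> Ey; apply/eqP; rewrite eq_le gap_le0/=.
apply: lb_le_inf; first by case: (gap_has_inf y).
move=> v [->//|[z [rho [/andP[h1 h2] hz ->]]]]; rewrite leNgt; apply/negP => h.
by apply: (hz y) Ey; exact: bump_support (ltW r0) hr h1 h.
Qed.

Lemma gap_hole z rho : 0 < rho <= 1 -> hole E z rho -> gap r E z <= - (r ^+ 2 * rho).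
Proof. by move=> h hz; apply: gap_le; right; exists z, rho; rewrite bump_center. Qed.

Lemma gap_lipschitz C : (forall z rho x y, 0 < rho ->
    `|bump r z rho x - bump r z rho y| <= C * N (- y ** x)) -> 0 <= C ->
  forall x y, `|gap r E x - gap r E y| <= C * N (- y ** x).
Proof.
move=> hC C0 x y; rewrite ler_distl; apply/andP; split.
  apply: lb_le_inf; first by case: (gap_has_inf x).
  move=> v [->|[z [rho [/andP[h1 h2] hz ->]]]].
    by rewrite subr_le0 (le_trans (gap_le0 y))// mulr_ge0// cc_norm_ge0.
  rewrite lerBlDr.
  apply: (@le_trans _ _ (bump r z rho y)); first by apply: gap_le; right; exists z, rho; rewrite h1.
  by have := hC z rho x y h1; rewrite ler_distl => /andP[]; lra.
rewrite -lerBlDr; apply: lb_le_inf; first by case: (gap_has_inf y).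
move=> v [->|[z [rho [/andP[h1 h2] hz ->]]]].
  by rewrite lerBlDr add0r (le_trans (gap_le0 x))// mulr_ge0// cc_norm_ge0.
rewrite lerBlDr.
apply: (@le_trans _ _ (bump r z rho x)); first by apply: gap_le; right; exists z, rho; rewrite h1.
by have := hC z rho x y h1; rewrite ler_distl => /andP[]; lra.
Qed.

(** Where [gap] vanishes it is maximal. Elsewhere a near-optimal bump at [a] has value
    at most [gap a / 2], and a bump of scale [rho] is at least [- r^2 rho]: so [rho] is
    bounded below by a constant [t0] that depends only on [a], and [quad_sym_diff] applies
    with one [eta] for all near-optimal bumps. *)
Lemma gap_sym_diff (a : V) (e : R) : 0 < e -> exists2 eta : R, 0 < eta & forall h, `|h| <= eta ->
  gap r E (a ** h) + gap r E (a ** (- h)) - 2 * gap r E a <= e * `|h|.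
Proof.
move=> e0; have := gap_le0 a; rewrite le_eqVlt => /orP[/eqP ->|g0].
  exists 1 => // h _; rewrite mulr0 subr0 (@le_trans _ _ 0)//.
    by have := gap_le0 (a ** h); have := gap_le0 (a ** - h); lra.
  by rewrite mulr_ge0// ltW.
pose g := - gap r E a; have g0' : 0 < g by rewrite oppr_gt0.
pose t0 := g / 2 / r ^+ 2.
have r2 : 0 < r ^+ 2 by rewrite exprn_gt0.
have t00 : 0 < t0 by rewrite !divr_gt0.
have t01 : t0 <= 1.
  by rewrite ler_pdivrMr// mul1r ler_pdivrMr//; have := gap_ge a; rewrite -/g /g; have := ltW r2; lra.
have M0 : 0 <= t0 ^- s by rewrite invr_ge0 exprn_ge0// ltW.
have e2 : 0 < e / 2 by rewrite divr_gt0.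
have [eta eta0 heta] := quad_sym_diff r0 M0 e2.
exists eta => // h hh.
have [->|hN0] := eqVneq h 0.
  by rewrite oppr0 (cg_mulx0 G) normr0 mulr0; lra.
have h0 : 0 < `|h| by rewrite normr_gt0.
(* The error [tau] of near-optimality counts twice, against half of
   [e * `|h|]. *)
pose tau := Num.min (e / 4 * `|h|) (g / 2).
have tau0 : 0 < tau by rewrite lt_min mulr_gt0 ?divr_gt0.
have tau1 : tau <= e / 4 * `|h| by rewrite ge_min lexx.
have tau2 : tau <= g / 2 by rewrite ge_min lexx orbT.
have [v Sv vg] := inf_adherent tau0 (gap_has_inf a).
have {}vg : v < gap r E a + tau by exact: vg.
have v0 : v < 0 by move: vg tau2 g0'; rewrite /g; lra.
case: Sv => [v00|[z [rho [/andP[p0 p1] hz ve]]]]; first by move: v0; rewrite v00 ltxx.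
set b := - z ** a.
have cb0 : cap r (dil rho^-1 b) < 0 by move: v0; rewrite ve pmulr_rlt0.
have cbE : cap r (dil rho^-1 b) = quad r (dil rho^-1 b).
  by apply/min_idPr; move: cb0; rewrite gt_min ltxx => /ltW.
have br : `|b| <= r.
  have := cap_lt0 (ltW r0) cb0; apply: le_trans.
  have {1}-> : b = dil rho (dil rho^-1 b) by rewrite dilM mulfV ?gt_eqF// dil1.
  apply: le_trans (dil_norm_le _ _ _) _; first by rewrite (ltW p0).
  by rewrite ler_piMl.
have pt : t0 <= rho.
  rewrite ler_pdivrMr//.
  have h1 : g / 2 <= - v by move: vg tau2; rewrite /g; lra.
  apply: le_trans h1 _; rewrite ve -mulrN ler_wpM2l ?(ltW p0)// lerNl.
  exact: cap_ge.
have wM j : rho ^- wt j <= t0 ^- s.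
  rewrite lef_pV2 ?posrE ?exprn_gt0//.
  have /andP[_ ws] := cg_weight_bounds G j.
  apply: (@le_trans _ _ (t0 ^+ wt j)); last by rewrite lerXn2r ?nnegrE// ltW.
  by rewrite ler_wiXn2l// ltW.
have hq := heta b h rho p0 br wM hh.
have bd k : gap r E (a ** k) <= rho * quad r (dil rho^-1 (b ** k)).
  apply: (@le_trans _ _ (bump r z rho (a ** k))).
    by apply: gap_le; right; exists z, rho; rewrite p0.
  rewrite /bump (cg_mulA G) ler_wpM2l ?(ltW p0)//.
  by rewrite ge_min lexx orbT.
have b1 := bd h; have b2 := bd (- h).
have b3 : rho * quad r (dil rho^-1 b) < gap r E a + tau by rewrite -cbE; move: vg; rewrite ve.
apply: (@le_trans _ _ (rho * (e / 2 * `|h|) + 2 * tau)).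
  apply: (@le_trans _ _ (rho * (quad r (dil rho^-1 (b ** h)) + quad r (dil rho^-1 (b ** - h))
    - 2 * quad r (dil rho^-1 b)) + 2 * tau)); last first.
    by rewrite lerD2r ler_wpM2l// ltW.
  have lin (x y z' A B C : R) : x <= A -> y <= B -> C < z' + tau ->
    x + y - 2 * z' <= A + B - 2 * C + 2 * tau by lra.
  by rewrite mulrBr mulrDr [rho * (2 * _)]mulrCA; exact: lin.
have : rho * (e / 2 * `|h|) <= e / 2 * `|h| by rewrite ler_piMl// mulr_ge0// ltW.
by move: tau1; lra.
Qed.

(** The holes of [E] given by porosity have centre [a ** h] and radius [l * N h]. *)
Lemma porous_gap_drop (l : R) (a : V) : 0 < l < 1 -> E a ->
  porous_at d l E a -> forall e : R, 0 < e -> exists h, [/\ h != 0, N h < e &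
    gap r E (a ** h) + gap r E (a ** (- h)) - 2 * gap r E a <= - (r ^+ 2 * l * N h)].
Proof.
move=> /andP[l0 l1] Ea [x [xa xlim xhole]] e e0.
pose e' := Num.min 1 e.
have [k hk] : exists k, (d (x k) a < e'%:E)%E.
  have : \forall k \near \oo, (d (x k) a < e'%:E)%E.
    apply: (xlim [set y | (y < e'%:E)%E]); apply: open_nbhs_nbhs.
    by split; [exact: open_ereal_lt_ereal|rewrite /= lte_fin lt_min ltr01].
  by case=> k _ hk; exists k; apply: hk => /=.
pose h := - a ** x k.
have ah : a ** h = x k by rewrite /h mulKNx.
have Nh : d (x k) a = (N h)%:E by rewrite cc_distE.
have h0 : h != 0 by apply/eqP => h0; apply: (xa k); rewrite -ah h0 (cg_mulx0 G).
have Nh0 : 0 < N h by exact: cc_norm_gt0.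
move: hk; rewrite Nh lte_fin lt_min => /andP[Nh1 Nhe].
exists h; split=> //; rewrite (gap_eq0 Ea) mulr0 subr0 -mulrA.
rewrite -[leRHS]addr0; apply: lerD; last exact: gap_le0.
rewrite ah; apply: gap_hole.
  by rewrite mulr_gt0//= mulr_ile1 ?ltW.
move=> y yl Ey; have : ([set y | (d (x k) y < l%:E * d (x k) a)%E] `&` E) y.
  by split=> //=; rewrite Nh cc_distE -EFinM lte_fin.
by rewrite xhole.
Qed.

End Gap.
End Bumps.

(** * Fast converging sums *)

Lemma geometric_sum_le (R : realType) (c : nat -> R) : (forall i, 0 <= c i) ->
  (forall i, c i.+1 <= c i / 2) -> forall m k, \sum_(m <= i < k) c i <= 2 * c m.
Proof.
move=> c0 hc m k; have [km|mk] := leqP k m; first by rewrite big_geq// mulr_ge0.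
rewrite -(subnKC (ltnW mk)); move: (k - m)%N => l {k mk}.
elim: l m => [|l IH] m; first by rewrite addn0 big_geq// mulr_ge0.
rewrite big_ltn ?addnS ?ltnS ?leq_addr// -addSn.
have := IH m.+1; have := hc m; lra.
Qed.

Lemma limn_le_ub (R : realType) (u : nat -> R) (b : R) (k0 : nat) :
  cvgn u -> (forall k, (k0 <= k)%N -> u k <= b) -> limn u <= b.
Proof.
move=> cu hu; apply: limr_le => //; near=> k; apply: hu.
near: k; exact: nbhs_infty_ge.
Unshelve. all: by end_near. Qed.

Section WeightedSums.
Variables (R : realType) (T : Type) (c : nat -> R) (g : nat -> T -> R) (M : R).
Hypotheses (c_ge0 : forall i, 0 <= c i) (c_half : forall i, c i.+1 <= c i / 2).
Hypotheses (M0 : 0 <= M) (gM : forall i x, - M <= g i x <= 0).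

Definition wsum (x : T) : R := limn (fun k => \sum_(0 <= i < k) c i * g i x).

Lemma wsum_cvg x : cvgn (fun k => \sum_(0 <= i < k) c i * g i x).
Proof.
apply: nonincreasing_is_cvgn.
  apply/nonincreasing_seqP => k; rewrite big_nat_recr//= gerDl mulr_ge0_le0//.
  by have /andP[] := gM k x.
exists (- (M * (2 * c 0%N))) => _ [k _ <-].
have := ler_wpM2l M0 (geometric_sum_le c_ge0 c_half 0 k).
rewrite -lerN2; move/le_trans; apply.
rewrite mulr_sumr -sumrN; apply: ler_sum => i _; rewrite mulrC -mulrN ler_wpM2l//.
by have /andP[] := gM i x.
Qed.

Lemma wsum_le x y D : (forall i, g i x - g i y <= D) -> 0 <= D ->
  wsum x - wsum y <= 2 * c 0%N * D.
Proof.
move=> hD D0; have cx := @wsum_cvg x; have cy := @wsum_cvg y.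
rewrite /wsum -limB//; apply: (limn_le_ub (k0 := 0%N)); first exact: is_cvgB.
move=> k _; rewrite -[leLHS]sumrB.
apply: (@le_trans _ _ (\sum_(0 <= i < k) c i * D)).
  by apply: ler_sum => i _; rewrite -mulrBr ler_wpM2l.
by rewrite -mulr_suml ler_wpM2r//; exact: geometric_sum_le.
Qed.

(** Terms before [j] are controlled one by one through [p], the [j]-th one gains [q], and
    those after [j] only have the crude bound [w], compensated by the small weight
    [c j.+1]. *)
Lemma wsum_sym_diff (x y a : T) (j : nat) (p q w : R) : 0 <= p -> 0 <= w ->
  let D i := g i x + g i y - 2 * g i a in
  (forall i, (i < j)%N -> D i <= p) -> D j <= - q -> (forall i, D i <= w) ->
  wsum x + wsum y - 2 * wsum a <= 2 * c 0%N * p - c j * q + 2 * c j.+1 * w.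
Proof.
move=> p0 w0 D Dlt Dj Dgt.
have cx := @wsum_cvg x; have cy := @wsum_cvg y; have ca := @wsum_cvg a.
have cD : \sum_(0 <= i < k) c i * D i @[k --> \oo] -->
    wsum x + wsum y - (wsum a + wsum a).
  rewrite (_ : (fun k => _) = (fun k => \sum_(0 <= i < k) c i * g i x) \+
    (fun k => \sum_(0 <= i < k) c i * g i y) \- ((fun k => \sum_(0 <= i < k) c i * g i a) \+
    (fun k => \sum_(0 <= i < k) c i * g i a))).
    exact: cvgB (cvgD cx cy) (cvgD ca ca).
  apply/funext => k /=; rewrite -!big_split -sumrB/=.
  by apply: eq_bigr => i _; rewrite /D; ring.
rewrite mulrDl mul1r -(cvg_lim _ cD)//; apply: (limn_le_ub (k0 := j.+1)).
  by apply/cvg_ex; eexists; exact: cD.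
move=> k jk; rewrite (big_cat_nat _ (n := j)) ?(ltnW jk)//= [X in _ + X]big_ltn//.
have s1 : \sum_(0 <= i < j) c i * D i <= 2 * c 0%N * p.
  apply: (@le_trans _ _ (\sum_(0 <= i < j) c i * p)).
    by rewrite !big_mkord; apply: ler_sum => i _; rewrite ler_wpM2l// Dlt.
  by rewrite -mulr_suml ler_wpM2r//; exact: geometric_sum_le.
have s2 : c j * D j <= - (c j * q) by rewrite -mulrN ler_wpM2l.
have s3 : \sum_(j.+1 <= i < k) c i * D i <= 2 * c j.+1 * w.
  apply: (@le_trans _ _ (\sum_(j.+1 <= i < k) c i * w)).
    by apply: ler_sum => i _; rewrite ler_wpM2l.
  by rewrite -mulr_suml ler_wpM2r//; exact: geometric_sum_le.
by rewrite addrA; apply: lerD => //; exact: lerD.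
Qed.

End WeightedSums.

(** * Symmetric differences and subgradients *)

Section Subdifferentials.
Variables (R : realType) (n s : nat) (G : carnotGroup R n s).
Local Notation V := 'rV[R]_n.
Local Notation "x ** y" := (cg_mul G x y) (at level 40, left associativity).
Local Notation d := (cc_dist G).
Local Notation N := (cc_norm G).

Lemma group_linearN (L : V -> R) h : group_linear G L -> L (- h) = - L h.
Proof.
move=> [LD _].
have L0 : L 0 = 0 by have := LD 0 0; rewrite (cg_mulx0 G); lra.
by have := LD h (- h); rewrite mulxN L0; lra.
Qed.

(** A subgradient [L] satisfies [L (- h) = - L h], so it cancels in the sum of the
    inequalities at [h] and at [- h]. *)
Lemma subdifferentiable_sym (f : V -> R) (a : V) (e : R) :
  pansu_subdifferentiable G f a -> 0 < e -> exists2 eta : R, 0 < eta &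
  forall h, h != 0 -> `|h| < eta ->
    - (e * (N h + N (- h))) <= f (a ** h) + f (a ** - h) - 2 * f a.
Proof.
move=> [L Llin]; rewrite limf_einfE => h0 e0.
pose q h := ((f (a ** h) - f a - L h)%R%:E / d h 0)%E.
have [V0 [W nW <-] hW] : exists2 y, [set ereal_inf (q @` U) | U in (0 : V)^'] y
    & ((- e)%:E < y)%E.
  apply: ereal_sup_gt; apply: lt_le_trans h0; by rewrite lte_fin oppr_lt0.
have /nbhs_ballP[eta /= eta0 hb] : \forall h \near (0 : V), h != 0 -> W h by exact: nW.
exists eta => // h hN hh.
have key k : k != 0 -> `|k| < eta -> - (e * N k) <= f (a ** k) - f a - L k.
  move=> k0 ke; have Wk : W k by apply: hb => //; rewrite -ball_normE/= sub0r normrN.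
  have : ((- e)%:E < (f (a ** k) - f a - L k)%:E / d k 0)%E.
    by apply: lt_le_trans hW _; apply: ereal_inf_lbound; exists k.
  rewrite cc_dist_0r; have Nk := cc_norm_gt0 G k0.
  by rewrite inver gt_eqF// -EFinM lte_fin ltr_pdivlMr// mulNr => /ltW.
have := key h hN hh; have := key (- h); rewrite oppr_eq0 normrN (group_linearN h Llin) => /(_ hN hh).
lra.
Qed.

End Subdifferentials.

Theorem theorem4p6 (R : realType) (n s : nat) (G : carnotGroup R n s)
    (E : set 'rV[R]_n) (hE : sigma_porous (cc_dist G) E) :
  exists f : 'rV[R]_n -> R,
    cc_lipschitz G f /\ (forall x, E x -> ~ pansu_subdifferentiable G f x).
Proof.
have [F [hF ->]] := hE.
pose N := cc_norm G; pose mul := cg_mul G.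
have [l hl] := @choice _ _ (fun i l => 0 < l < 1 /\
    forall a, F i a -> porous_at (cc_dist G) l (F i) a)
  (fun i => let: ex_intro2 l p q := hF i in ex_intro _ l (conj p q)).
have l0 i : 0 < l i by have [/andP[]] := hl i.
have [r r0 hr] := cc_norm_small G.
have r0' := ltW r0; have r20 : 0 < r ^+ 2 by rewrite exprn_gt0.
have [C C0 hC] := bump_lipschitz G r0'.
have C0' := ltW C0.
(* [c j.+1 = c j * be j / 2] bounds the contribution of the terms after
   [j] by a quarter of the gain [c j * (r ^+ 2 * l j)] of the [j]-th one. *)
pose be i := Num.min 1 (r ^+ 2 * l i / (8 * C)).
have be0 i : 0 < be i by rewrite lt_min ltr01 divr_gt0 ?mulr_gt0.
have be1 i : be i <= 1 by rewrite ge_min lexx.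
have be2 i : C * be i <= r ^+ 2 * l i / 8.
  apply: (@le_trans _ _ (C * (r ^+ 2 * l i / (8 * C)))).
    by rewrite ler_wpM2l// ge_min lexx orbT.
  by rewrite le_eqVlt; apply/orP; left; apply/eqP; field; rewrite gt_eqF.
pose c := fix c (i : nat) : R := if i is i'.+1 then c i' * be i' / 2 else 1.
have cS i : c i.+1 = c i * be i / 2 by [].
have c0 i : 0 < c i by elim: i => //= i IH; rewrite divr_gt0 ?mulr_gt0.
have c0' i : 0 <= c i by exact: ltW.
have chalf i : c i.+1 <= c i / 2 by rewrite cS ler_pM2r ?invr_gt0// ler_piMr.
pose g i := gap G r (F i).
have gM i x : - r ^+ 2 <= g i x <= 0 by rewrite gap_ge gap_le0.
have gl i x y : `|g i x - g i y| <= C * N (mul (- y) x) by exact: gap_lipschitz.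
exists (wsum c g); split.
  exists (2 * C) => [|x y]; first by rewrite mulr_ge0.
  rewrite cc_distE -EFinM lee_fin.
  have D0 : 0 <= C * N (mul (- y) x) by rewrite mulr_ge0// cc_norm_ge0.
  have key x' y' : (forall i, g i x' - g i y' <= C * N (mul (- y) x)) ->
      wsum c g x' - wsum c g y' <= 2 * C * N (mul (- y) x).
    by move=> /(wsum_le c0' chalf (ltW r20) gM)/(_ D0); rewrite mulr1 -mulrA.
  rewrite ler_norml lerNl opprB; apply/andP; split; apply: key => i.
    by apply: le_trans (ler_norm _) _; rewrite distrC.
  exact: le_trans (ler_norm _) _.
move=> a [j _ Fja] hsub.
have [C1 C10 hC1] := cc_norm_opp G.
have [C2 C20 hC2] := norm_le_cc_norm G.
pose A := c j * (r ^+ 2 * l j).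
have A0 : 0 < A by rewrite !mulr_gt0.
(* With these [e1] and [e2], the lower bound of the symmetric difference
   is [- A / 8] and the terms before [j] contribute at most [A / 8], in units
   of [N h], where [A] is the gain. *)
pose e1 := A / (8 * (1 + C1)).
have e10 : 0 < e1 by rewrite divr_gt0// mulr_gt0// addr_gt0.
pose e2 := A / (16 * C2).
have e20 : 0 < e2 by rewrite divr_gt0// mulr_gt0.
have [eta1 eta10 h1] := subdifferentiable_sym hsub e10.
have [eta2 eta20 h2] : exists2 eta : R, 0 < eta & forall i, (i < j)%N -> forall h, `|h| <= eta ->
    g i (mul a h) + g i (mul a (- h)) - 2 * g i a <= e2 * `|h|.
  elim: (j) => [|m [eta eta0 IH]]; first by exists 1.
  have [eta' eta'0 h'] := gap_sym_diff G (F m) r0 a e20.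
  exists (Num.min eta eta'); first by rewrite lt_min eta0.
  move=> i; rewrite ltnS leq_eqVlt => /orP[/eqP ->|im] h; rewrite le_min => /andP[ha hb].
    exact: h'.
  exact: IH.
pose eta := Num.min (Num.min eta1 eta2) 1.
have eta0 : 0 < eta by rewrite !lt_min eta10 eta20 ltr01.
have [l1 lF] := hl j.
have etaC : 0 < eta / C2 by rewrite divr_gt0.
have [h [h0 hN drop]] := porous_gap_drop r0 hr l1 Fja (lF a Fja) etaC.
have Nh0 : 0 < N h by exact: cc_norm_gt0.
have {}hN : C2 * N h < eta by rewrite mulrC -ltr_pdivlMr.
have hC2h : `|h| <= C2 * N h by apply: hC2; apply: lt_le_trans hN _; rewrite ge_min lexx orbT.
have [he1 he2] : `|h| < eta1 /\ `|h| <= eta2.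
  by have := le_lt_trans hC2h hN; rewrite !lt_min => /andP[/andP[h3 h4] _]; split=> //; exact: ltW.
have lower := h1 h h0 he1.
have upper := @wsum_sym_diff R _ c g (r ^+ 2) c0' chalf (ltW r20) gM (mul a h) (mul a (- h)) a j
  (e2 * C2 * N h) (r ^+ 2 * l j * N h) (2 * C * N h).
have {}upper : wsum c g (mul a h) + wsum c g (mul a (- h)) - 2 * wsum c g a <=
    2 * 1 * (e2 * C2 * N h) - c j * (r ^+ 2 * l j * N h) + 2 * c j.+1 * (2 * C * N h).
  apply: upper => //.
  - by apply: mulr_ge0; [apply: mulr_ge0|]; exact: ltW.
  - by apply: mulr_ge0; [apply: mulr_ge0|exact: ltW].
  - move=> i ij; apply: le_trans (h2 i ij h he2) _; rewrite -mulrA ler_wpM2l//; exact: ltW.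
  - move=> i.
    (* Left invariance makes both steps, from [a] to [a h] and from [a h^-1]
       to [a], of size [N h]. *)
    have E1 : mul (- a) (mul a h) = h by exact: mulKx.
    have E2 : mul (- mul a (- h)) a = h.
      by rewrite /mul oppM opprK -(cg_mulA G) mulNx (cg_mulx0 G).
    have b1 : g i (mul a h) - g i a <= C * N h.
      by apply: le_trans (ler_norm _) _; rewrite -[in leRHS]E1.
    have b2 : g i (mul a (- h)) - g i a <= C * N h.
      by apply: le_trans (ler_norm _) _; rewrite distrC -[in leRHS]E2.
    move: b1 b2; move: (g i _) (g i _) (g i _) => x y z; lra.
have e1E : e1 * (1 + C1) = A / 8 by rewrite /e1; field; rewrite gt_eqF// addr_gt0.
have e2E : e2 * C2 = A / 16 by rewrite /e2; field; rewrite gt_eqF.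
have low2 : - (A / 8 * N h) <= wsum c g (mul a h) + wsum c g (mul a (- h)) - 2 * wsum c g a.
  apply: le_trans lower; rewrite lerN2 -e1E -mulrA ler_wpM2l ?(ltW e10)//.
  by rewrite mulrDl mul1r lerD2l.
have := le_trans low2 upper; rewrite leNgt => /negP; apply.
have -> : 2 * 1 * (e2 * C2 * N h) - c j * (r ^+ 2 * l j * N h) + 2 * c j.+1 * (2 * C * N h) =
    (2 * (A / 16) - A + 2 * (c j * (C * be j))) * N h by rewrite e2E cS /A; field.
rewrite -[ltRHS]mulNr ltr_pM2r//.
have : c j * (C * be j) <= A / 8 by rewrite /A -mulrA ler_wpM2l.
by move: A0; clear; move: A (c j * _) => x y; lra.
Qed.
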